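(* Let $f:\subseteq\mathcal D\rightrightarrows\mathcal D$ be a problem on the set $\mathcal D$ of Turing degrees. Then: \begin{enumerate} \item $f^\diamond\equiv_{\mathrm{sW}}f^{[*]}$; \item $\widehat{f^\diamond}\equiv_{\mathrm{sW}}f^\omega$, if $f$ is pointed. \end{enumerate}
   Context: Problems. A represented space $(X,\delta_X)$ is a set $X$ with a surjective partial map $\delta_X:\subseteq\mathbb N^{\mathbb N}\to X$. A partial function $F:\subseteq\mathbb N^{\mathbb N}\to\mathbb N^{\mathbb N}$ is computable if there is a computable monotone (w.r.t. the prefix order) word function $\varphi:\mathbb N^*\to\mathbb N^*$ with $F(p)=\sup_{w\sqsubseteq p}\varphi(w)$ for all $p\in\mathrm{dom}(F)$. For a partial multivalued function $f:\subseteq X\rightrightarrows Y$ between represented spaces, $F:\subseteq\mathbb N^{\mathbb N}\to\mathbb N^{\mathbb N}$ is a realizer of $f$, written $F\vdash f$, if $\delta_YF(p)\in f\delta_X(p)$ for all $p\in\mathrm{dom}(f\delta_X)$. A problem is a multivalued function with a realizer. Composition: $g\circ f(x)=\{z:(\exists y\in f(x))\,z\in g(y)\}$ with $\mathrm{dom}(g\circ f)=\{x\in\mathrm{dom}(f):f(x)\subseteq\mathrm{dom}(g)\}$. The realizer version of $f$ is $f^{\mathrm r}:=\delta_Y^{-1}\circ f\circ\delta_X:\subseteq\mathbb N^{\mathbb N}\rightrightarrows\mathbb N^{\mathbb N}$. The set $\mathcal D$ of Turing degrees is represented by $\deg:\mathbb N^{\mathbb N}\to\mathcal D$, $\deg(p)=\{q\in\mathbb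 N^{\mathbb N}:q\equiv_{\mathrm T}p\}$. Tupling. $\langle q,p\rangle:=q(0)p(0)q(1)p(1)\dots$; $\langle p_0,p_1,\dots\rangle$ is the standard countable tupling, e.g. $\langle p_0,p_1,\dots\rangle(\langle i,j\rangle)=p_i(j)$, and $\langle q_0,\dots,q_k\rangle$ is a standard finite tupling. $\langle\mathrm{id}\times f\rangle$ is the problem $\langle q,p\rangle\mapsto\{\langle q,r\rangle:r\in f(p)\}$. Universal function. $\Phi$ is a fixed standard total representation of a set of continuous partial functions on $\mathbb N^{\mathbb N}$ (with natural domains), where a name $q$ encodes the graph of a monotone word function approximating $\Phi_q$; $\mathsf U_q:=\Phi_q$, and $\mathsf U\langle q,p\rangle:=\mathsf U_q(p)$ is a computable partial function. The smn-theorem holds: for every computable (continuous) $F:\subseteq\mathbb N^{\mathbb N}\to\mathbb N^{\mathbb N}$ there is a total computable (continuous) $S$ with $\mathsf U_{S(q)}(p)=F\langle q,p\rangle$ for all $\langle q,p\rangle\in\mathrm{dom}(F)$. The names $q$ allow the digits $0,1,2$ as dummy symbols: adding or removing them does not change $\mathsf U_q$. Operators, for $f:\subseteq\mathbb N^{\mathbb N}\rightrightarrows\mathbb N^{\mathbb N}$ (for other problems $f$ apply the operators $f^\diamond,f^{[*]},f^\omega$ to $f^{\mathrm r}$). Put $L_f:=\mathsf U\circ\langle\mathrm{id}\times f\rangle$. Diamond: a finite run is $\langle q_0,\dots,q_k\rangle$ with $q_{i+1}\in L_f(q_i)$ for all $i<k$; an infinite run is $\langle q_0,q_1,\dots\rangle$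 with this for all $i$. A finite run is successful if $q_k(0)=0$ and $q_i(0)\ne0$ for all $i<k$; it stalls if $q_k\notin\mathrm{dom}(L_f)$ and $q_i(0)\ne0$ for all $i\le k$; an infinite run is unsuccessful if $q_i(0)\ne0$ for all $i$. $f^\diamond(q_0)$ is the set of all $q_k$ such that there are $q_1,\dots,q_{k-1}$ with $\langle q_0,\dots,q_k\rangle$ a successful finite run; $\mathrm{dom}(f^\diamond)$ is the set of $q_0$ such that no run starting with $q_0$ stalls or is infinite and unsuccessful. Finite powers: $f^{[0]}:=\mathrm{id}$, $f^{[1]}:=\langle\mathrm{id}\times f\rangle$, $f^{[n+1]}:=\langle\mathrm{id}\times f\rangle\circ\mathsf U\circ f^{[n]}$ for $n\ge1$. For loop: $f^{[*]}:=\bigsqcup_{n\in\mathbb N}f^{[n]}$, the coproduct $(n,p)\mapsto\{n\}\times f^{[n]}(p)$ with $(n,p)$ in the domain iff $p\in\mathrm{dom}(f^{[n]})$. Omega: $f^\omega(p):=\langle f^{[0]}(p),f^{[1]}(p),\dots\rangle=\{\langle r_0,r_1,\dots\rangle:(\forall n)\ r_n\in f^{[n]}(p)\}$ for all $p$ with $p\in\mathrm{dom}(f^{[n]})$ for all $n$. Parallelization: for $g:\subseteq X\rightrightarrows Y$, $\widehat g:\subseteq X^{\mathbb N}\rightrightarrows Y^{\mathbb N}$, $(x_i)_i\mapsto\prod_ig(x_i)$. Reducibilities. $f\le_{\mathrm W}g$ if there are computable $H,K:\subseteq\mathbb N^{\mathbb N}\to\mathbb N^{\mathbb N}$ with $H\langle\mathrm{id},GK\rangle\vdash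 f$ whenever $G\vdash g$; $f\le_{\mathrm{sW}}g$ if there are computable $H,K$ with $HGK\vdash f$ whenever $G\vdash g$; $\equiv_{\mathrm{sW}}$ is the induced equivalence. A problem $f$ is pointed if $\mathrm{id}\le_{\mathrm W}f$ for the identity $\mathrm{id}$ on $\mathbb N^{\mathbb N}$, i.e. if $f$ has a computable input. *)

(* Defs.v *)
From mathcomp Require Import all_boot.
From mathcomp Require Import boolp classical_sets.
From Stdlib Require Cantor.

Set Implicit Arguments.
Unset Strict Implicit.
Unset Printing Implicit Defensive.

Local Open Scope classical_set_scope.

(* The total recursive functions: minimization is only applied to functions
   that have a zero for every choice of the parameters. *)
Inductive recursive : forall n : nat, (n.-tuple nat -> nat) -> Prop :=
| rec_zero n : recursive (fun _ : n.-tuple nat => 0)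
| rec_succ : recursive (fun v : 1.-tuple nat => (thead v).+1)
| rec_proj n (i : 'I_n) : recursive (fun v : n.-tuple nat => tnth v i)
| rec_comp m n (g : m.-tuple nat -> nat) (h : 'I_m -> n.-tuple nat -> nat) :
    recursive g -> (forall i, recursive (h i)) ->
    recursive (fun v : n.-tuple nat => g [tuple h i v | i < m])
| rec_prim n (g : n.-tuple nat -> nat) (h : n.+2.-tuple nat -> nat) :
    recursive g -> recursive h ->
    recursive (fun v : n.+1.-tuple nat =>
      nat_rect (fun=> nat) (g [tuple of behead v])
        (fun k r => h [tuple of k :: r :: behead v]) (thead v))
| rec_min n (g : n.+1.-tuple nat -> nat)
    (reg : forall v : n.-tuple nat, exists k, g [tuple of k :: v] == 0) :
    recursive g -> recursive (fun v : n.-tuple nat => ex_minn (reg v)).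

Definition computable_word (phi : seq nat -> seq nat) : Prop :=
  recursive (fun v : 1.-tuple nat =>
    CodeSeq.code (phi (CodeSeq.decode (thead v)))).

Definition baire := nat -> nat.

Definition word_prefix (w : seq nat) (p : baire) : Prop :=
  w = mkseq p (size w).

(* The supremum of W in the prefix order on finite and infinite words is the
   infinite word p. *)
Definition is_sup (W : set (seq nat)) (p : baire) : Prop :=
  (forall w, W w -> word_prefix w p) /\
  (forall n, exists2 w, W w & n <= size w).

Definition computable (F : baire -> option baire) : Prop :=
  exists phi : seq nat -> seq nat,
    [/\ computable_word phi,
        {homo phi : v w / prefix v w} &
        forall p q, F p = Some q ->
          is_sup [set phi w | w in [set w | word_prefix w p]] q].

Definition bpair (q p : baire) : baire :=
  fun n => if odd n then p n./2 else q n./2.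

Definition evens (t : baire) : baire := fun n => t n.*2.
Definition odds (t : baire) : baire := fun n => t n.*2.+1.

Definition btuple (r : nat -> baire) : baire :=
  fun k => let: (i, j) := Cantor.of_nat k in r i j.

Definition bproj (p : baire) (i : nat) : baire :=
  fun j => p (Cantor.to_nat (i, j)).

Lemma bpairE t : bpair (evens t) (odds t) = t.
Proof.
apply/funext => n; rewrite /bpair /evens /odds.
by rewrite -[n in RHS]odd_double_half; case: (odd n).
Qed.

Lemma evens_bpair q p : evens (bpair q p) = q.
Proof. by apply/funext => n; rewrite /evens /bpair odd_double doubleK. Qed.

Lemma odds_bpair q p : odds (bpair q p) = p.
Proof.
by apply/funext => n; rewrite /odds /bpair /= odd_double /= uphalf_double.
Qed.

Lemma bproj_btuple r i : bproj (btuple r) i = r i.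
Proof. by apply/funext => j; rewrite /bproj /btuple Cantor.cancel_of_to. Qed.

Lemma btuple_bproj p : btuple (bproj p) = p.
Proof.
apply/funext => k; rewrite /bproj /btuple.
by case E: (Cantor.of_nat k) => [i j]; rewrite -E Cantor.cancel_to_of.
Qed.

(* [rep p x]: p is a name of x. *)
Record repSpace := RepSpace {
  rep_sort :> Type;
  rep : baire -> set rep_sort;
  rep_functional : forall p, is_subset1 (rep p);
  rep_surjective : forall x, exists p, rep p x
}.
Arguments rep : clear implicits.

Definition mdom (X Y : Type) (f : X -> set Y) : set X := [set x | f x !=set0].

Definition mcomp (X Y Z : Type) (g : Y -> set Z) (f : X -> set Y) : X -> set Z :=
  fun x => [set z | f x `<=` mdom g /\ exists2 y, f x y & g y z].

Definition multifun (X Y : repSpace) := X -> set Y.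

Definition realizer (X Y : repSpace) (F : baire -> option baire)
    (f : multifun X Y) : Prop :=
  forall p x, rep X p x -> mdom f x ->
    exists q y, [/\ F p = Some q, rep Y q y & f x y].

Definition is_problem (X Y : repSpace) (f : multifun X Y) : Prop :=
  exists F, realizer F f.

Definition W_le (X Y Z T : repSpace) (f : multifun X Y) (g : multifun Z T) :=
  exists H K : baire -> option baire,
    [/\ computable H, computable K &
        forall G, realizer G g ->
          realizer (fun p => obind (fun r => H (bpair p r)) (obind G (K p))) f].

Definition sW_le (X Y Z T : repSpace) (f : multifun X Y) (g : multifun Z T) :=
  exists H K : baire -> option baire,
    [/\ computable H, computable K &
        forall G, realizer G g -> realizer (fun p => obind H (obind G (K p))) f].

Definition sW_equiv (X Y Z T : repSpace) (f : multifun X Y) (g : multifun Z T) :=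
  sW_le f g /\ sW_le g f.

#[local] Obligation Tactic := idtac.

Program Definition Baire : repSpace :=
  @RepSpace baire (fun p => [set p]) _ _.
Next Obligation. by move=> p x y -> ->. Qed.
Next Obligation. by move=> p; exists p. Qed.

Program Definition Nat : repSpace :=
  @RepSpace nat (fun p => [set p 0]) _ _.
Next Obligation. by move=> p x y -> ->. Qed.
Next Obligation. by move=> n; exists (fun=> n). Qed.

Program Definition prod_space (X Y : repSpace) : repSpace :=
  @RepSpace (X * Y)
    (fun p => [set x | rep X (evens p) x.1 /\ rep Y (odds p) x.2]) _ _.
Next Obligation.
move=> X Y p [x1 x2] [y1 y2] /= [h1 h2] [k1 k2].
by rewrite (rep_functional h1 k1) (rep_functional h2 k2).
Qed.
Next Obligation.
move=> X Y [x y]; have [p px] := rep_surjective x.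
have [q qy] := rep_surjective y.
by exists (bpair p q); rewrite /= evens_bpair odds_bpair.
Qed.

Program Definition seq_space (X : repSpace) : repSpace :=
  @RepSpace (nat -> X)
    (fun p => [set x | forall i, rep X (bproj p i) (x i)]) _ _.
Next Obligation.
move=> X p x y /= hx hy; apply/funext => i.
exact: (rep_functional (hx i) (hy i)).
Qed.
Next Obligation.
move=> X x; have [r hr] := choice (fun i => rep_surjective (x i)).
by exists (btuple r) => i; rewrite bproj_btuple.
Qed.

Definition turing_le (q p : baire) : Prop :=
  exists F, computable F /\ F p = Some q.

Definition turing_equiv (q p : baire) : Prop := turing_le q p /\ turing_le p q.

Definition degree (p : baire) : set baire := [set q | turing_equiv q p].

Program Definition Degrees : repSpace :=
  @RepSpace {d : set baire | exists p, d = degree p}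
    (fun p => [set d | sval d = degree p]) _ _.
Next Obligation.
move=> p [x hx] [y hy] /= ex ey; apply: eq_exist.
by rewrite ex ey.
Qed.
Next Obligation. by case=> d [p dp]; exists p. Qed.

Definition rep_inv (Y : repSpace) : Y -> set baire := fun y => [set q | rep Y q y].

Definition realizer_version (X Y : repSpace) (f : multifun X Y) :
    multifun Baire Baire :=
  mcomp (@rep_inv Y) (mcomp f (rep X)).

Definition mid (X : repSpace) : multifun X X := fun x => [set x].

Definition pointed (X Y : repSpace) (f : multifun X Y) : Prop :=
  W_le (@mid Baire) f.

Definition parallel (X Y : repSpace) (g : multifun X Y) :
    multifun (seq_space X) (seq_space Y) :=
  fun x => [set y | forall i, g (x i) (y i)].

(* The digits 0, 1, 2 are dummies; the digit e + 3 puts the pair of words coded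
   by e into the graph. *)
Definition listed (q : baire) (v w : seq nat) : Prop :=
  exists n, q n = (Cantor.to_nat (CodeSeq.code v, CodeSeq.code w)).+3.

(* Every q is a name: if the listed outputs for prefixes of p are incompatible
   or of bounded length, then p is not in the domain. *)
Definition Phi (q : baire) : multifun Baire Baire :=
  fun p => [set r | is_sup [set w | exists2 v, word_prefix v p & listed q v w] r].

Definition U : multifun Baire Baire := fun t => Phi (evens t) (odds t).

Section Operators.
Variable f : multifun Baire Baire.

Definition id_times : multifun Baire Baire :=
  fun t => [set bpair (evens t) r | r in f (odds t)].

Definition run_step : multifun Baire Baire := mcomp U id_times.

Definition successful (q : nat -> baire) (k : nat) : Prop :=
  [/\ forall i, i < k -> run_step (q i) (q i.+1),
      q k 0 = 0 &
      forall i, i < k -> q i 0 <> 0].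

Definition stalls (q : nat -> baire) (k : nat) : Prop :=
  [/\ forall i, i < k -> run_step (q i) (q i.+1),
      ~ mdom run_step (q k) &
      forall i, i <= k -> q i 0 <> 0].

Definition unsuccessful (q : nat -> baire) : Prop :=
  (forall i, run_step (q i) (q i.+1)) /\ (forall i, q i 0 <> 0).

Definition diamond : multifun Baire Baire :=
  fun q0 => [set r |
    (forall q, q 0 = q0 -> (forall k, ~ stalls q k) /\ ~ unsuccessful q) /\
    exists q k, [/\ q 0 = q0, successful q k & r = q k]].

Fixpoint fin_power (n : nat) : multifun Baire Baire :=
  match n with
  | 0 => @mid Baire
  | 1 => id_times
  | n'.+1 => mcomp id_times (mcomp U (fin_power n'))
  end.

Definition for_loop : multifun (prod_space Nat Baire) (prod_space Nat Baire) :=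
  fun x => [set y | y.1 = x.1 /\ fin_power x.1 x.2 y.2].

Definition omega : multifun Baire Baire :=
  fun p => [set btuple r | r in [set r | forall n, fin_power n p (r n)]].

End Operators.

(* Main.v *)
Require Import Defs.
From mathcomp Require Import all_boot zify.
From mathcomp Require Import boolp classical_sets.
From Stdlib Require Cantor.

(* The realizer version [g] of a problem on Turing degrees is insensitive to
   finite modifications of the answers: if [r] is an answer then so is [w ++ r],
   for every word [w]. For [q0] in the domain of [diamond g] one can therefore
   search for finite words which, used as beginnings of the oracle answers,
   drive the run from [q0] to a state whose first digit is [0]. Such words exist
   because a successful run exists, and they work with arbitrary answers
   appended because no run stalls. Their number is a number of calls that
   suffices, so [diamond] reduces to [for_loop]. Conversely, a loop with [n]
   calls is a run of a self-reproducing program with a counter. For the second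
   equivalence, all instances of a sequence are run one after the other by a
   single program, with a call on a computable input of [f] after each of them,
   so that the sequence of calls never ends; the result of the [i]-th instance is
   read off from the finite power with the corresponding number of calls. *)

Set Implicit Arguments.
Unset Strict Implicit.
Unset Printing Implicit Defensive.

(** * Recursive functions on coded types *)

(** A strong reduction hands the post-processing only the answer, never the original input. The
    machines therefore keep all their data in the parameter of a program name: [id_times] returns
    that name unchanged next to the answer, and entries with empty output store the parameter in the
    name without changing the named function.

    A for loop must announce its number of calls before it sees any answer. The guessed words need
    not be prefixes of the real answers; since they are prepended and not compared, the number of
    calls is the same for all answers.

    A finite power stops before the universal function is applied to its last answer. In the first
    equivalence this last step is left to the post-processing; in the second the call after each
    instance also makes its final stage visible in some finite power. *)

Lemma recursive_ext n (f g : n.-tuple nat -> nat) :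
  recursive f -> f =1 g -> recursive g.
Proof. by move=> rf /funext <-. Qed.

Definition rec1 (g : nat -> nat) :=
  recursive (fun v : 1.-tuple nat => g (thead v)).

Definition rec2 (g : nat -> nat -> nat) :=
  recursive (fun v : 2.-tuple nat => g (tnth v ord0) (tnth v ord_max)).

Lemma recursive_comp1 n g (a : n.-tuple nat -> nat) :
  rec1 g -> recursive a -> recursive (fun v => g (a v)).
Proof.
move=> rg ra; apply: recursive_ext (rec_comp rg (fun=> ra)) _ => v.
by rewrite /thead tnth_mktuple.
Qed.

Lemma recursive_comp2 n g (a b : n.-tuple nat -> nat) :
  rec2 g -> recursive a -> recursive b -> recursive (fun v => g (a v) (b v)).
Proof.
move=> rg ra rb.
pose h (i : 'I_2) v := if i == ord0 then a v else b v.
have rh i : recursive (h i) by rewrite /h; case: (i == ord0).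
apply: recursive_ext (rec_comp rg rh) _ => v.
by rewrite !tnth_mktuple /h.
Qed.

Lemma recursive_const n c : recursive (fun _ : n.-tuple nat => c).
Proof.
elim: c => [|c IH]; first exact: rec_zero.
exact: (recursive_comp1 rec_succ IH).
Qed.

(** [rec_prim] recurses on the first entry of its own argument; feeding it [a v :: v] frees the
    recursion argument and keeps all of [v] as parameters. *)
Lemma recursive_nat_rect n (g a : n.-tuple nat -> nat)
    (h : n.+2.-tuple nat -> nat) :
  recursive g -> recursive h -> recursive a ->
  recursive (fun v => nat_rect (fun=> nat) (g v)
    (fun k r => h [tuple of k :: r :: v]) (a v)).
Proof.
move=> rg rh ra.
pose p (i : 'I_n.+1) v :=
  if unlift ord0 i is Some j then tnth v j else a v.
have rp i : recursive (p i).
  by rewrite /p; case: unliftP => [j _|_] //; exact: rec_proj.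
apply: recursive_ext (rec_comp (rec_prim rg rh) rp) _ => v.
have -> : [tuple p i v | i < n.+1] = [tuple of a v :: v].
  apply: eq_from_tnth => i; rewrite tnth_mktuple /p.
  by case: unliftP => [j|] ->; rewrite ?tnth0 ?tnthS.
have -> : [tuple of behead [tuple of a v :: v]] = v by exact: val_inj.
by rewrite theadE; congr nat_rect; apply/funext => k; apply/funext => r;
  congr (h _); exact: val_inj.
Qed.

Lemma rec2_nat_rect (g : nat -> nat) (h : nat -> nat -> nat -> nat) :
  rec1 g ->
  recursive (fun v : 3.-tuple nat =>
    h (tnth v ord0) (tnth v (lift ord0 ord0)) (tnth v ord_max)) ->
  rec2 (fun x n => nat_rect (fun=> nat) (g x) (fun k r => h k r x) n).
Proof.
move=> rg rh; pose i0 : 'I_4 := ord0; pose i1 : 'I_4 := lift ord0 ord0.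
pose i2 : 'I_4 := lift ord0 (lift ord0 ord0).
(* The recursion passes [k :: r :: v] with [v] the pair of [x] and [n]; [h] sees the first three
   entries. *)
pose s (j : 'I_3) (v : 4.-tuple nat) : nat := tnth v (widen_ord (leqnSn 3) j).
have rs j : recursive (s j) by exact: rec_proj.
apply: recursive_ext (recursive_nat_rect (recursive_comp1 rg (rec_proj (ord0 : 'I_2)))
  (rec_comp rh rs) (rec_proj ord_max)) _ => v.
congr nat_rect; apply/funext => k; apply/funext => r.
by rewrite !tnth_mktuple /s !(tnth_nth 0) /=; case: v => [[|x []]].
Qed.

Lemma rec1_nat_rect c (h : nat -> nat -> nat) :
  rec2 h -> rec1 (fun n => nat_rect (fun=> nat) c h n).
Proof.
move=> rh; have r2 : rec2 (fun x n => nat_rect (fun=> nat) c h n).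
  apply: (@rec2_nat_rect (fun=> c) (fun k r _ => h k r)).
    exact: recursive_const.
  by apply: recursive_comp2; [|exact: rec_proj|exact: rec_proj].
by apply: (recursive_comp2 r2); exact: (rec_proj (ord0 : 'I_1)).
Qed.

Lemma rec1_pred : rec1 predn.
Proof.
apply: recursive_ext (rec1_nat_rect (h := fun k _ => k) 0 (rec_proj ord0)) _ => v.
by case: (thead v).
Qed.

Lemma rec1_id : rec1 id.
Proof. exact: (rec_proj (ord0 : 'I_1)). Qed.

Lemma rec2_add : rec2 addn.
Proof.
have h := rec2_nat_rect (h := fun _ r _ => r.+1) rec1_id
  (recursive_comp1 rec_succ (rec_proj (lift ord0 ord0 : 'I_3))).
apply: recursive_ext h _ => v; elim: (tnth v ord_max) => [|k /= ->].
  by rewrite addn0.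
by rewrite addnS.
Qed.

Lemma rec2_sub : rec2 subn.
Proof.
have h := rec2_nat_rect (h := fun _ r _ => r.-1) rec1_id
  (recursive_comp1 rec1_pred (rec_proj (lift ord0 ord0 : 'I_3))).
apply: recursive_ext h _ => v; elim: (tnth v ord_max) => [|k /= ->].
  by rewrite subn0.
by rewrite subnS.
Qed.

Lemma rec2_mul : rec2 muln.
Proof.
have h := rec2_nat_rect (g := fun=> 0) (h := fun _ r x => r + x) (recursive_const 1 0)
  (recursive_comp2 rec2_add (rec_proj (lift ord0 ord0 : 'I_3)) (rec_proj ord_max)).
apply: recursive_ext h _ => v; elim: (tnth v ord_max) => [|k /= ->].
  by rewrite muln0.
by rewrite mulnSr.
Qed.

(** * Inverting the Cantor pairing *)

Definition tri n := nat_rect (fun=> nat) 0 (fun i m => i.+1 + m) n.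

Lemma rec1_tri : rec1 tri.
Proof.
apply: rec1_nat_rect; apply: (recursive_comp2 rec2_add); last exact: rec_proj.
by apply: (recursive_comp1 rec_succ); exact: rec_proj.
Qed.

Lemma tri_homo m n : m <= n -> tri m <= tri n.
Proof.
by elim: n => [|n IH]; rewrite leq_eqVlt => /orP[/eqP ->|] //= /IH; lia.
Qed.

(* The summand [1 - (a - b)] is the truth value of [a <= b]. *)
Definition tri_root n :=
  nat_rect (fun=> nat) 0 (fun k r => r + (1 - (tri r.+1 - k.+1))) n.

Lemma rec1_tri_root : rec1 tri_root.
Proof.
apply: rec1_nat_rect; apply: (recursive_comp2 rec2_add); first exact: rec_proj.
apply: (recursive_comp2 rec2_sub); first exact: recursive_const.
apply: (recursive_comp2 rec2_sub); last first.
  by apply: (recursive_comp1 rec_succ); exact: rec_proj.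
apply: (recursive_comp1 rec1_tri).
by apply: (recursive_comp1 rec_succ); exact: rec_proj.
Qed.

Lemma tri_rootP n : tri (tri_root n) <= n < tri (tri_root n).+1.
Proof.
elim: n => [|n IH] //=; rewrite -/(tri_root n).
have := IH; set r := tri_root n; rewrite /= -/(tri r) => /andP[h1 h2].
have [h|h] : r.+1 + tri r = n.+1 \/ n.+1 < r.+1 + tri r by lia.
  have -> : r + (1 - (r.+1 + tri r - n.+1)) = r.+1 by lia.
  by rewrite /= -/(tri r); lia.
have -> : r + (1 - (r.+1 + tri r - n.+1)) = r by lia.
by rewrite -/(tri r); lia.
Qed.

Lemma tri_root_to_nat x y : tri_root (Cantor.to_nat (x, y)) = y + x.
Proof.
(* [tri] follows the recursion inside [Cantor.to_nat], so this holds by computation. *)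
have : Cantor.to_nat (x, y) = y + tri (y + x) by [].
have := tri_rootP (Cantor.to_nat (x, y)).
set r := tri_root _; move: (Cantor.to_nat _) => n /andP[h1 h2] e.
apply/eqP; rewrite eqn_leq; apply/andP; split; rewrite leqNgt; apply/negP => h.
  by have := tri_homo h; rewrite /= -/(tri _); lia.
by have := tri_homo h; lia.
Qed.

Definition pair_code (x y : nat) := Cantor.to_nat (x, y).

Lemma rec2_pair_code : rec2 pair_code.
Proof.
apply: (@recursive_ext _ (fun v : 2.-tuple nat =>
  tnth v ord_max + tri (tnth v ord_max + tnth v ord0))) => //.
apply: (recursive_comp2 rec2_add); first exact: rec_proj.
apply: (recursive_comp1 rec1_tri).
by apply: (recursive_comp2 rec2_add); exact: rec_proj.
Qed.

Lemma rec1_snd : rec1 (fun n => (Cantor.of_nat n).2).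
Proof.
apply: (@recursive_ext _ (fun v : 1.-tuple nat =>
  thead v - tri (tri_root (thead v)))).
  apply: (recursive_comp2 rec2_sub rec1_id).
  by apply: (recursive_comp1 rec1_tri); exact: rec1_tri_root.
move=> v; rewrite -[thead v]Cantor.cancel_to_of; case: (Cantor.of_nat _) => x y.
rewrite tri_root_to_nat Cantor.cancel_of_to /=.
by rewrite -/(tri (y + x)) addnK.
Qed.

Lemma rec1_fst : rec1 (fun n => (Cantor.of_nat n).1).
Proof.
apply: (@recursive_ext _ (fun v : 1.-tuple nat =>
  tri_root (thead v) - (Cantor.of_nat (thead v)).2)).
  by apply: (recursive_comp2 rec2_sub); [exact: rec1_tri_root|exact: rec1_snd].
move=> v; rewrite -[thead v]Cantor.cancel_to_of; case: (Cantor.of_nat _) => x y.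
by rewrite tri_root_to_nat Cantor.cancel_of_to /= addnC addnK.
Qed.

(** * Functions tracked on codes *)

Class Enc (T : Type) := enc : T -> nat.

#[global] Instance Enc_nat : Enc nat := id.
#[global] Instance Enc_bool : Enc bool := nat_of_bool.
#[global] Instance Enc_pair A B `{Enc A} `{Enc B} : Enc (A * B) :=
  fun x => pair_code (enc x.1) (enc x.2).
#[global] Instance Enc_option A `{Enc A} : Enc (option A) :=
  fun o => if o is Some x then (enc x).+1 else 0.
#[global] Instance Enc_seq A `{Enc A} : Enc (seq A) :=
  fun s => CodeSeq.code (map enc s).

(** The tracking function is unconstrained outside the range of [enc], so no decoding of arbitrary
    numbers is required. *)
Definition recu A B `{Enc A} `{Enc B} (f : A -> B) :=
  exists2 g, rec1 g & forall x, g (enc x) = enc (f x).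

Section Recu.
Context {A : Type} `{Enc A}.

Lemma recu_id : recu (fun x : A => x).
Proof. by exists id => //; exact: rec1_id. Qed.

Lemma recu_const B `{Enc B} (b : B) : recu (fun _ : A => b).
Proof. by exists (fun=> enc b) => //; exact: recursive_const. Qed.

Lemma recu_comp B `{Enc B} C `{Enc C} (f : B -> C) (g : A -> B) :
  recu f -> recu g -> recu (fun x => f (g x)).
Proof.
move=> [f' rf ff] [g' rg gg]; exists (fun n => f' (g' n)).
  exact: (recursive_comp1 rf rg).
by move=> x; rewrite gg ff.
Qed.

Lemma recu_pair B `{Enc B} C `{Enc C} (f : A -> B) (g : A -> C) :
  recu f -> recu g -> recu (fun x => (f x, g x)).
Proof.
move=> [f' rf ff] [g' rg gg]; exists (fun n => pair_code (f' n) (g' n)).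
  exact: (recursive_comp2 rec2_pair_code rf rg).
by move=> x; rewrite ff gg.
Qed.

Lemma recu_fst B `{Enc B} C `{Enc C} (f : A -> B * C) :
  recu f -> recu (fun x => (f x).1).
Proof.
move=> rf; apply: recu_comp rf; exists (fun n => (Cantor.of_nat n).1).
  exact: rec1_fst.
by move=> [x y]; rewrite /enc /Enc_pair /pair_code Cantor.cancel_of_to.
Qed.

Lemma recu_snd B `{Enc B} C `{Enc C} (f : A -> B * C) :
  recu f -> recu (fun x => (f x).2).
Proof.
move=> rf; apply: recu_comp rf; exists (fun n => (Cantor.of_nat n).2).
  exact: rec1_snd.
by move=> [x y]; rewrite /enc /Enc_pair /pair_code Cantor.cancel_of_to.
Qed.

Lemma recu_nat_rect B `{Enc B} (g : A -> B) (h : A -> nat -> B -> B) (n : A -> nat) :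
  recu (fun y : A * (nat * B) => h y.1 y.2.1 y.2.2) -> recu g -> recu n ->
  recu (fun x => nat_rect (fun=> B) (g x) (h x) (n x)).
Proof.
move=> [h' rh hh] [g' rg gg] [n' rn nn].
exists (fun x => nat_rect (fun=> nat) (g' x)
  (fun k r => h' (pair_code x (pair_code k r))) (n' x)).
  have r2 : rec2 (fun x n => nat_rect (fun=> nat) (g' x)
      (fun k r => h' (pair_code x (pair_code k r))) n).
    apply: (@rec2_nat_rect g' (fun k r x => h' (pair_code x (pair_code k r)))) => //.
    apply: (recursive_comp1 rh).
    apply: (recursive_comp2 rec2_pair_code); first exact: rec_proj.
    by apply: (recursive_comp2 rec2_pair_code); exact: rec_proj.
  exact: (recursive_comp2 r2 rec1_id rn).
move=> x; rewrite nn {2}/enc /Enc_nat; elim: (n x) => [|k /= ->]; first exact: gg.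
exact: (hh (x, (k, _))).
Qed.

End Recu.

Section RecuNat.
Context {A : Type} `{Enc A}.

Lemma recu_S (f : A -> nat) : recu f -> recu (fun x => (f x).+1).
Proof.
move=> rf; apply: (@recu_comp A _ nat _ nat _ S f) rf.
by exists S => //; exact: rec_succ.
Qed.

Lemma recu_pred (f : A -> nat) : recu f -> recu (fun x => (f x).-1).
Proof.
move=> rf; apply: (@recu_comp A _ nat _ nat _ predn f) rf.
by exists predn => //; exact: rec1_pred.
Qed.

Lemma recu_rec2 (h : nat -> nat -> nat) (f g : A -> nat) :
  rec2 h -> recu f -> recu g -> recu (fun x => h (f x) (g x)).
Proof.
move=> rh [f' rf ff] [g' rg gg]; exists (fun n => h (f' n) (g' n)).
  exact: (recursive_comp2 rh rf rg).
by move=> x; rewrite ff gg.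
Qed.

Lemma recu_add (f g : A -> nat) : recu f -> recu g -> recu (fun x => f x + g x).
Proof. exact: (recu_rec2 rec2_add). Qed.

Lemma recu_sub (f g : A -> nat) : recu f -> recu g -> recu (fun x => f x - g x).
Proof. exact: (recu_rec2 rec2_sub). Qed.

Lemma recu_mul (f g : A -> nat) : recu f -> recu g -> recu (fun x => f x * g x).
Proof. exact: (recu_rec2 rec2_mul). Qed.

Lemma recu_to_nat (f g : A -> nat) :
  recu f -> recu g -> recu (fun x => Cantor.to_nat (f x, g x)).
Proof. exact: (recu_rec2 rec2_pair_code). Qed.

Lemma recu_of_nat (f : A -> nat) : recu f -> recu (fun x => Cantor.of_nat (f x)).
Proof.
move=> rf; apply: (recu_comp (f := Cantor.of_nat)) rf.
exists id; first exact: rec1_id.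
move=> x; rewrite -[in LHS](Cantor.cancel_to_of x) /enc /Enc_pair.
by case: (Cantor.of_nat x).
Qed.

Lemma recu_ext B `{Enc B} (f g : A -> B) : recu f -> f =1 g -> recu g.
Proof. by move=> rf /funext <-. Qed.

(** The truth value serves as the length of a recursion: no step gives [g], one step gives [f]. *)
Lemma recu_if B `{Enc B} (b : A -> bool) (f g : A -> B) :
  recu b -> recu f -> recu g -> recu (fun x => if b x then f x else g x).
Proof.
move=> [b' rb bb] rf rg.
have rb' : recu (fun x => b x : nat) by exists b'.
have rf' : recu (fun y : A * (nat * B) => f y.1).
  by apply: (recu_comp (f := f)) rf _; apply: recu_fst; exact: recu_id.
apply: recu_ext (recu_nat_rect (h := fun x _ _ => f x) rf' rg rb') _ => x.
by case: (b x).
Qed.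

End RecuNat.

(** A number is its own code, so [recu f] and its coded form unfold to the same statement. This lets
    booleans, options and lists be treated by arithmetic on their codes. *)
Lemma recu_enc A `{Enc A} B `{Enc B} (f : A -> B) : recu f -> recu (fun x => enc (f x)).
Proof. by []. Qed.

Lemma recu_of_enc A `{Enc A} B `{Enc B} (f : A -> B) : recu (fun x => enc (f x)) -> recu f.
Proof. by []. Qed.

Section RecuOps.
Context {A : Type} `{Enc A}.

Lemma recu_leq (f g : A -> nat) : recu f -> recu g -> recu (fun x => f x <= g x).
Proof.
move=> rf rg; apply: recu_of_enc; have r1 := recu_sub (recu_const 1) (recu_sub rf rg).
apply: recu_ext r1 _ => x; rewrite /enc /Enc_bool; lia.
Qed.

Lemma recu_eqn (f g : A -> nat) : recu f -> recu g -> recu (fun x => f x == g x).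
Proof.
move=> rf rg; apply: recu_of_enc.
have r1 := recu_sub (recu_const 1) (recu_add (recu_sub rf rg) (recu_sub rg rf)).
apply: recu_ext r1 _ => x; rewrite /enc /Enc_bool; lia.
Qed.

Lemma recu_odd (f : A -> nat) : recu f -> recu (fun x => odd (f x)).
Proof.
move=> rf; apply: recu_of_enc.
apply: recu_ext (recu_nat_rect (h := fun _ _ r => 1 - r) _ (recu_const 0) rf) _.
  by apply: recu_sub; [exact: recu_const|do 2!apply: recu_snd; exact: recu_id].
move=> x; elim: (f x) => //= n ->; rewrite /enc /Enc_bool; lia.
Qed.

Lemma recu_half (f : A -> nat) : recu f -> recu (fun x => (f x)./2).
Proof.
move=> rf.
(* The recursion is [k.+1./2 = k - k./2]. *)
apply: recu_ext (recu_nat_rect (h := fun _ k r => k - r) _ (recu_const 0) rf) _.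
  apply: recu_sub; last by do 2!apply: recu_snd; exact: recu_id.
  by apply: recu_fst; apply: recu_snd; exact: recu_id.
move=> x; elim: (f x) => //= n ->; lia.
Qed.

Lemma recu_double (f : A -> nat) : recu f -> recu (fun x => (f x).*2).
Proof.
by move=> rf; apply: recu_ext (recu_add rf rf) _ => x; rewrite addnn.
Qed.

Lemma recu_expn c (f : A -> nat) : recu f -> recu (fun x => c ^ f x).
Proof.
move=> rf.
apply: recu_ext (recu_nat_rect (h := fun _ _ r => c * r) _ (recu_const 1) rf) _.
  by apply: recu_mul; [exact: recu_const|do 2!apply: recu_snd; exact: recu_id].
by move=> x; elim: (f x) => //= n ->; rewrite expnS.
Qed.

Lemma recu_andb (f g : A -> bool) : recu f -> recu g -> recu (fun x => f x && g x).
Proof.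
by move=> rf rg; apply: (recu_if (f := g) (g := fun=> false)) => //; exact: recu_const.
Qed.

Lemma recu_some B `{Enc B} (f : A -> B) : recu f -> recu (fun x => Some (f x)).
Proof. by move=> rf; apply: recu_of_enc; exact: (recu_S (f := fun x => enc (f x))). Qed.

(** [None] has code 0, and for [Some b] the last step of the recursion has index [enc b], which is
    what the tracking function of [h] needs. *)
Lemma recu_omatch B `{Enc B} C `{Enc C} (o : A -> option B) (h : A -> B -> C) g :
  recu (fun y : A * B => h y.1 y.2) -> recu g -> recu o ->
  recu (fun x => if o x is Some b then h x b else g x).
Proof.
move=> [h' rh hh] rg ro; apply: recu_of_enc.
apply: recu_ext (recu_nat_rect (h := fun x k _ => h' (pair_code (enc x) k)) _
  (recu_enc rg) (recu_enc ro)) _.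
  apply: (@recu_comp _ _ nat _ nat _ h'); first by exists h'.
  apply: recu_to_nat; first by apply: recu_enc; apply: recu_fst; exact: recu_id.
  by apply: recu_fst; apply: recu_snd; exact: recu_id.
by move=> x; case: (o x) => //= b; rewrite (hh (x, b)).
Qed.

End RecuOps.

Ltac recu_basic := lazymatch goal with
  | |- recu (fun x => x) => exact: recu_id
  | |- recu (fun _ => ?c) => exact: recu_const
  | |- recu (fun x => addn (@?a x) (@?b x)) => apply: recu_add
  | |- recu (fun x => subn (@?a x) (@?b x)) => apply: recu_sub
  | |- recu (fun x => muln (@?a x) (@?b x)) => apply: recu_mul
  | |- recu (fun x => Cantor.to_nat (@?a x, @?b x)) => apply: recu_to_nat
  | |- recu (fun x => Cantor.of_nat (@?a x)) => apply: recu_of_nat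
  | |- recu (fun x => leq (@?a x) (@?b x)) => apply: recu_leq
  | |- recu (fun x => @eq_op _ (@?a x) (@?b x)) => apply: recu_eqn
  | |- recu (fun x => odd (@?a x)) => apply: recu_odd
  | |- recu (fun x => half (@?a x)) => apply: recu_half
  | |- recu (fun x => double (@?a x)) => apply: recu_double
  | |- recu (fun x => expn _ (@?a x)) => apply: recu_expn
  | |- recu (fun x => andb (@?a x) (@?b x)) => apply: recu_andb
  | |- recu (fun x => Some (@?a x)) => apply: recu_some
  | |- recu (fun x => nat_rect _ (@?a x) (@?b x) (@?c x)) => apply: recu_nat_rect
  | |- recu (fun x => pair (@?a x) (@?b x)) => apply: recu_pair
  | |- recu (fun x => fst (@?a x)) => apply: recu_fst
  | |- recu (fun x => snd (@?a x)) => apply: recu_snd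
  | |- recu (fun x => S (@?a x)) => apply: recu_S
  | |- recu (fun x => predn (@?a x)) => apply: recu_pred
  | H : recu ?f |- recu (fun x => ?f (@?a x)) => refine (recu_comp (g := a) H _)
  | |- _ => first [apply: recu_if | apply: recu_omatch]
  end.

(** A hook: it is redefined once lists and codes are covered, and [recu_auto] then uses the
    extension. *)
Ltac recu_step := recu_basic.
Ltac recu_eta := lazymatch goal with
  | |- recu (fun _ => _) => fail
  | |- @recu ?A ?B ?a ?b ?f => change (@recu A B a b (fun x => f x))
  end.
Ltac recu_auto := repeat (first [assumption | recu_eta | recu_step]; cbn [fst snd]).

(** * Iteration and lists *)

Lemma recu_iter A `{Enc A} B `{Enc B} (n : A -> nat) (h : A -> B -> B) g :
  recu (fun y : A * B => h y.1 y.2) -> recu g -> recu n ->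
  recu (fun x => iter (n x) (h x) (g x)).
Proof.
move=> rh rg rn; apply: recu_ext (recu_nat_rect (h := fun x _ => h x) _ rg rn) _.
  apply: (recu_comp (f := fun y : A * B => h y.1 y.2)
    (g := fun y : A * (nat * B) => (y.1, y.2.2))) => //; by recu_auto.
by move=> x; elim: (n x) => //= k ->.
Qed.

(** The code of [x :: s] is [2 ^ x] times an odd number that determines [s]. Halving until the
    number is odd separates the two; the code itself bounds the number of halvings. *)
Definition uncode c :=
  iter c (fun y : nat * nat => if odd y.2 then y else (y.1.+1, y.2./2)) (0, c).

Lemma recu_uncode : recu uncode.
Proof. by apply: recu_iter; recu_auto. Qed.

Lemma uncode_cons x s : uncode (CodeSeq.code (x :: s)) = (x, (CodeSeq.code s).*2.+1).
Proof.
have odd_m : odd (CodeSeq.code s).*2.+1 by rewrite /= odd_double.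
rewrite /uncode /=; move: (_.*2.+1) odd_m => m odd_m; set F := (X in iter _ X).
have Fm k y : iter k F (y, m) = (y, m) by elim: k => //= k ->; rewrite /F /= odd_m.
have Fx y : iter x F (y, 2 ^ x * m) = (y + x, m).
  elim: x y => [|x IH] y; first by rewrite mul1n addn0.
  by rewrite iterSr {2}/F /= expnS -mulnA oddM /= mul2n doubleK IH addSnnS.
have le : x <= 2 ^ x * m.
  apply: leq_trans (ltnW (ltn_expl x (isT : 1 < 2))) _.
  by rewrite leq_pmulr //; case: m odd_m {Fm Fx}.
by rewrite -{1}(subnK le) iterD Fx add0n Fm.
Qed.

Section RecuSeq.
Context {A B : Type} `{Enc A} `{Enc B}.

Lemma recu_cons (f : A -> B) (l : A -> seq B) :
  recu f -> recu l -> recu (fun x => f x :: l x).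
Proof.
move=> rf rl; apply: recu_of_enc.
have ef := recu_enc rf; have el := recu_enc rl.
apply: (@recu_ext _ _ _ _ (fun x => 2 ^ enc (f x) * (enc (l x)).*2.+1)) => //.
by recu_auto.
Qed.

Lemma recu_lmatch C `{Enc C} (l : A -> seq B) (h : A -> B -> seq B -> C) g :
  recu (fun y : A * (B * seq B) => h y.1 y.2.1 y.2.2) -> recu g -> recu l ->
  recu (fun x => if l x is b :: s then h x b s else g x).
Proof.
move=> [h' rh hh] rg rl; apply: recu_of_enc.
have eg := recu_enc rg; have el := recu_enc rl.
have [d ed dE] : exists2 d, recu d & forall x, d x = uncode (enc (l x)).
  by eexists; first exact: (recu_comp recu_uncode el).
have eA := recu_enc (@recu_id A _).
apply: (@recu_ext _ _ _ _ (fun x => if enc (l x) == 0 then enc (g x) else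
    h' (pair_code (enc x) (pair_code (d x).1 (d x).2./2)))).
  apply: recu_if => //; first by recu_auto.
  apply: (@recu_comp _ _ nat _ nat _ h'); first by exists h'.
  by apply: recu_to_nat => //; apply: recu_to_nat; recu_auto.
move=> x; rewrite dE; case: (l x) => [|b s] //.
rewrite /enc /Enc_seq [map _ _]/= uncode_cons /= uphalf_double muln_eq0 expn_eq0 /=.
exact: (hh (x, (b, s))).
Qed.

End RecuSeq.

Lemma size_enc B `{Enc B} (s : seq B) : size s <= enc s.
Proof.
elim: s => //= b s; rewrite /enc /Enc_seq /=; set c := CodeSeq.code _ => h.
by rewrite -[_.+1]mul1n leq_mul ?expn_gt0 // ltnS (leq_trans h) // -addnn leq_addr.
Qed.

(** Folding is iterated on the accumulator and the remaining list. The code of the list is a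
    sufficient number of rounds by [size_enc], and rounds with an empty list change nothing. *)
Lemma recu_foldl A B C `{Enc A} `{Enc B} `{Enc C} (l : A -> seq B)
    (h : A -> C -> B -> C) g :
  recu (fun y : A * (C * B) => h y.1 y.2.1 y.2.2) -> recu g -> recu l ->
  recu (fun x => foldl (h x) (g x) (l x)).
Proof.
move=> rh rg rl; have el := recu_enc rl.
pose F x (y : C * seq B) := if y.2 is b :: s then (h x y.1 b, s) else y.
apply: (@recu_ext _ _ _ _ (fun x => (iter (enc (l x)) (F x) (g x, l x)).1)).
  apply: recu_fst; apply: recu_iter; recu_auto.
  apply: recu_lmatch; recu_auto.
  exact: (recu_comp (f := fun y : A * (C * B) => h y.1 y.2.1 y.2.2)
    (g := fun y : A * (C * seq B) * (B * seq B) => (y.1.1, (y.1.2.1, y.2.1)))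
    rh ltac:(recu_auto)).
move=> x; have : size (l x) <= enc (l x) by exact: size_enc.
move: (g x) (enc (l x)).
elim: (l x) => [|b s IH] c n /=.
  have F0 k : iter k (F x) (c, [::]) = (c, [::]) by elim: k => //= k ->.
  by rewrite F0.
by case: n => [|n] //; rewrite ltnS iterSr; exact: IH.
Qed.

Section RecuSeq2.
Context {A B : Type} `{Enc A} `{Enc B}.

Lemma recu_size (l : A -> seq B) : recu l -> recu (fun x => size (l x)).
Proof.
move=> rl.
apply: recu_ext (recu_foldl (h := fun _ n _ => n.+1) _ (recu_const 0) rl) _; first
  by recu_auto.
move=> x; rewrite -[RHS]add0n; elim: (l x) 0 => [|b s IH] n /=; first by rewrite addn0.
by rewrite IH addSnnS.
Qed.

Lemma recu_catrev (l l' : A -> seq B) :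
  recu l -> recu l' -> recu (fun x => catrev (l x) (l' x)).
Proof.
move=> rl rl'.
apply: recu_ext (recu_foldl (h := fun _ s b => b :: s) _ rl' rl) _.
  by apply: recu_cons; recu_auto.
by move=> x; elim: (l x) (l' x) => //=.
Qed.

Lemma recu_rev (l : A -> seq B) : recu l -> recu (fun x => rev (l x)).
Proof. by move=> rl; apply: recu_catrev => //; exact: recu_const. Qed.

Lemma recu_cat (l l' : A -> seq B) :
  recu l -> recu l' -> recu (fun x => l x ++ l' x).
Proof.
move=> rl rl'; apply: recu_ext (recu_catrev (recu_rev rl) rl') _ => x.
by rewrite catrevE revK.
Qed.

Lemma recu_rcons (f : A -> B) (l : A -> seq B) :
  recu f -> recu l -> recu (fun x => rcons (l x) (f x)).
Proof.
move=> rf rl; apply: (@recu_ext _ _ _ _ (fun x => l x ++ [:: f x])).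
  by apply: recu_cat => //; apply: recu_cons => //; exact: recu_const.
by move=> x; rewrite cats1.
Qed.

Lemma recu_drop (n : A -> nat) (l : A -> seq B) :
  recu n -> recu l -> recu (fun x => drop (n x) (l x)).
Proof.
move=> rn rl.
apply: recu_ext (recu_iter (h := fun _ s => behead s) _ rl rn) _.
  by apply: (recu_lmatch (h := fun _ _ s => s) (g := fun=> [::])); recu_auto.
move=> x; elim: (n x) (l x) => [|k IH] s; first by rewrite drop0.
by rewrite iterSr IH; case: s.
Qed.

Lemma recu_take (n : A -> nat) (l : A -> seq B) :
  recu n -> recu l -> recu (fun x => take (n x) (l x)).
Proof.
move=> rn rl; have rs := recu_size rl.
apply: (@recu_ext _ _ _ _ (fun x => rev (drop (size (l x) - n x) (rev (l x))))).
  by apply: recu_rev; apply: recu_drop; [recu_auto|exact: recu_rev].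
move=> x; rewrite drop_rev revK.
case: (leqP (n x) (size (l x))) => h; first by rewrite subKn.
by rewrite (eqP (ltnW h)) subn0 take_size take_oversize // ltnW.
Qed.

Lemma recu_onth (n : A -> nat) (l : A -> seq B) :
  recu n -> recu l -> recu (fun x => onth (l x) (n x)).
Proof.
move=> rn rl; apply: (@recu_ext _ _ _ _ (fun x =>
    if drop (n x) (l x) is b :: s then Some b else None)).
  by apply: recu_lmatch; recu_auto; exact: recu_drop.
by move=> x; elim: (n x) (l x) => [|k IH] [|b s] //=.
Qed.

Lemma recu_nth b (n : A -> nat) (l : A -> seq B) :
  recu n -> recu l -> recu (fun x => nth b (l x) (n x)).
Proof.
move=> rn rl; apply: (@recu_ext _ _ _ _ (fun x =>
    if onth (l x) (n x) is Some c then c else b)).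
  by apply: recu_omatch; recu_auto; exact: recu_onth.
by move=> x; elim: (n x) (l x) => [|k IH] [|c s] //=.
Qed.

End RecuSeq2.

Lemma recu_mkseq A B `{Enc A} `{Enc B} (f : A -> nat -> B) (n : A -> nat) :
  recu (fun y : A * nat => f y.1 y.2) -> recu n ->
  recu (fun x => mkseq (f x) (n x)).
Proof.
move=> rf rn.
apply: recu_ext (recu_nat_rect (h := fun x k s => rcons s (f x k)) _ (recu_const [::]) rn) _.
  apply: recu_rcons; recu_auto.
  exact: (recu_comp (f := fun y : A * nat => f y.1 y.2)
    (g := fun y : A * (nat * seq B) => (y.1, y.2.1)) rf ltac:(recu_auto)).
by move=> x; elim: (n x) => //= k ->; rewrite mkseqS.
Qed.

Lemma enc_seq_nat (s : seq nat) : enc s = CodeSeq.code s.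
Proof. by rewrite /enc /Enc_seq map_id. Qed.

Definition decode_words z := map CodeSeq.decode (CodeSeq.decode z).
Definition code_words (s : seq (seq nat)) := CodeSeq.code (map CodeSeq.code s).

Lemma code_wordsK : cancel code_words decode_words.
Proof.
move=> s; rewrite /code_words /decode_words CodeSeq.codeK -map_comp.
by rewrite map_id_in // => x _ /=; rewrite CodeSeq.codeK.
Qed.

Section RecuCode.
Context {A : Type} `{Enc A}.

Lemma recu_code (s : A -> seq nat) : recu s -> recu (fun x => CodeSeq.code (s x)).
Proof. by move=> /recu_enc rs; apply: recu_ext rs _ => x; rewrite enc_seq_nat. Qed.

Lemma recu_decode (n : A -> nat) : recu n -> recu (fun x => CodeSeq.decode (n x)).
Proof.
move=> rn; apply: recu_of_enc; apply: recu_ext rn _ => x.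
by rewrite enc_seq_nat CodeSeq.decodeK.
Qed.

Lemma recu_decode_words (n : A -> nat) : recu n -> recu (fun x => decode_words (n x)).
Proof.
move=> rn; apply: recu_of_enc; apply: recu_ext rn _ => x.
rewrite /enc /Enc_seq /decode_words -map_comp.
rewrite map_id_in ?CodeSeq.decodeK // => y _ /=.
by rewrite enc_seq_nat CodeSeq.decodeK.
Qed.

Lemma recu_code_words (s : A -> seq (seq nat)) : recu s -> recu (fun x => code_words (s x)).
Proof.
move=> /recu_enc rs; apply: recu_ext rs _ => x; congr CodeSeq.code.
by apply: eq_map => y; rewrite enc_seq_nat.
Qed.

Lemma recu_eqseq (s t : A -> seq nat) : recu s -> recu t -> recu (fun x => s x == t x).
Proof.
move=> rs rt; apply: recu_ext (recu_eqn (recu_code rs) (recu_code rt)) _ => x.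
exact: (can_eq CodeSeq.codeK).
Qed.

End RecuCode.

Lemma recuP (phi : seq nat -> seq nat) : recu phi <-> computable_word phi.
Proof.
split=> [[g rg hg]|rphi].
  apply: recursive_ext rg _ => v; have := hg (CodeSeq.decode (thead v)).
  by rewrite !enc_seq_nat CodeSeq.decodeK.
exists (fun n => CodeSeq.code (phi (CodeSeq.decode n))) => // s.
by rewrite !enc_seq_nat CodeSeq.codeK.
Qed.

Ltac recu_step ::= lazymatch goal with
  | |- recu (fun x => cons (@?a x) (@?b x)) => apply: recu_cons
  | |- recu (fun x => cat (@?a x) (@?b x)) => apply: recu_cat
  | |- recu (fun x => rcons (@?a x) (@?b x)) => apply: recu_rcons
  | |- recu (fun x => size (@?a x)) => apply: recu_size
  | |- recu (fun x => drop (@?a x) (@?b x)) => apply: recu_drop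
  | |- recu (fun x => take (@?a x) (@?b x)) => apply: recu_take
  | |- recu (fun x => nth _ (@?a x) (@?b x)) => apply: recu_nth
  | |- recu (fun x => onth (@?a x) (@?b x)) => apply: recu_onth
  | |- recu (fun x => mkseq (@?a x) (@?b x)) => apply: recu_mkseq
  | |- recu (fun x => decode_words (@?a x)) => apply: recu_decode_words
  | |- recu (fun x => code_words (@?a x)) => apply: recu_code_words
  | |- recu (fun x => CodeSeq.decode (@?a x)) => apply: recu_decode
  | |- recu (fun x => CodeSeq.code (@?a x)) => apply: recu_code
  | |- recu (fun x => @eq_op _ (@?a x) (@?b x)) =>
      first [apply: recu_eqn | apply: recu_eqseq]
  | |- recu (fun x => foldl (@?h x) (@?a x) (@?b x)) => apply: recu_foldl
  | |- recu (fun x => iter (@?a x) (@?b x) (@?c x)) => apply: recu_iter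
  | |- _ => first [recu_basic | apply: recu_lmatch]
  end.


(** * Uniform computability on Baire space *)

Lemma prefix_mkseq (p : baire) s t : s <= t -> prefix (mkseq p s) (mkseq p t).
Proof.
by move=> /subnKC <-; rewrite /mkseq iotaD map_cat; exact: prefix_prefix.
Qed.

Lemma word_prefix_mkseq p s : word_prefix (mkseq p s) p.
Proof. by rewrite /word_prefix size_mkseq. Qed.
#[local] Hint Resolve word_prefix_mkseq : core.

Lemma take_mkseq (p : baire) s j : j <= s -> take j (mkseq p s) = mkseq p j.
Proof. by move=> js; rewrite /mkseq -map_take take_iota (minn_idPl js). Qed.

Lemma word_prefix_nth w p i : word_prefix w p -> i < size w -> nth 0 w i = p i.
Proof. by move=> ew h; rewrite ew nth_mkseq. Qed.

Lemma word_prefix_eq p q :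
  (forall n, exists w, [/\ word_prefix w p, word_prefix w q & n < size w]) -> p = q.
Proof.
move=> h; apply/funext => n; have [w [wp wq nw]] := h n.
by rewrite -(word_prefix_nth wp nw) (word_prefix_nth wq nw).
Qed.

Lemma onth_word w p n m : word_prefix w p -> onth w n = Some m -> m = p n.
Proof.
move=> wp e; have nw : n < size w by rewrite -onthTE e.
by rewrite -(word_prefix_nth wp nw) -odflt_onth e.
Qed.

Definition monotone (phi : seq nat -> seq nat) := {homo phi : v w / prefix v w}.

(** Every prefix of [p] is some [mkseq p s], and monotonicity carries a long output over to all
    longer segments. *)
Lemma is_supP phi p q : monotone phi ->
  is_sup [set phi w | w in [set w | word_prefix w p]]%classic q <->
  (forall s, word_prefix (phi (mkseq p s)) q) /\
  (forall n, exists s0, forall s, s0 <= s -> n <= size (phi (mkseq p s))).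
Proof.
move=> mphi; split=> [[h1 h2]|[h1 h2]]; split.
- by move=> s; apply: h1; exists (mkseq p s) => //; exact: word_prefix_mkseq.
- move=> n; have [_ [w wp <-] nw] := h2 n; exists (size w) => s ws.
  apply: leq_trans nw (size_prefix (mphi _ _ _)).
  by rewrite wp; exact: prefix_mkseq.
- by move=> _ [w wp <-]; rewrite wp.
- move=> n; have [s hs] := h2 n; exists (phi (mkseq p s)); last exact: hs.
  by exists (mkseq p s) => //; exact: word_prefix_mkseq.
Qed.

Lemma is_sup_unique W p q : is_sup W p -> is_sup W q -> p = q.
Proof.
move=> [p1 p2] [q1 _]; apply: word_prefix_eq => n; have [w Ww nw] := p2 n.+1.
by exists w; split; [exact: p1|exact: q1|].
Qed.

(* The map [I x |-> T x], for [x] ranging over [D], extends to a computable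
   partial function. *)
Definition ucomp X (D : set X) (I T : X -> baire) :=
  exists phi : seq nat -> seq nat, [/\ recu phi, monotone phi & forall x, D x ->
    (forall s, word_prefix (phi (mkseq (I x) s)) (T x)) /\
    (forall n, exists s0, forall s, s0 <= s -> n <= size (phi (mkseq (I x) s)))].

(** Goes through the prefixes of [w] and appends at most one digit for each. Consulting [G] on
    prefixes, and not on [w] alone, makes the result monotone even if [G] is not. *)
Definition grow (G : seq nat * nat -> option nat) (w : seq nat) (j : nat) :=
  nat_rect (fun=> seq nat) [::]
    (fun k u => if G (take k.+1 w, size u) is Some m then rcons u m else u) j.

Lemma recu_grow G : recu G -> recu (fun w => grow G w (size w)).
Proof. by move=> rG; rewrite /grow; recu_auto. Qed.

Lemma growS G w j : grow G w j.+1 =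
  if G (take j.+1 w, size (grow G w j)) is Some m then rcons (grow G w j) m
  else grow G w j.
Proof. by []. Qed.

Lemma grow_take G v w j : prefix v w -> j <= size v -> grow G w j = grow G v j.
Proof.
move=> vw; elim: j => //= j IH jv; rewrite IH; last exact: ltnW.
suff -> : take j.+1 w = take j.+1 v by [].
by case/prefixP: vw jv => u -> jv; rewrite takel_cat.
Qed.

Lemma grow_homo G w i j : i <= j -> prefix (grow G w i) (grow G w j).
Proof.
move=> /subnK <-; elim: (j - i) => [|k IH]; first exact: prefix_refl.
apply: prefix_trans IH _; rewrite addSn /=; case: (G _) => [m|].
  exact: prefix_rcons.
exact: prefix_refl.
Qed.

Lemma grow_monotone G : monotone (fun w => grow G w (size w)).
Proof.
move=> v w vw; rewrite -(grow_take G vw) //.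
by apply: grow_homo; exact: size_prefix.
Qed.

(** The workhorse for computability: digits are produced one at a time, and [G] has to behave well
    on inputs from [D] only. *)
Lemma ucomp_digits X (D : set X) I T (G : seq nat * nat -> option nat) :
  recu G ->
  (forall x, D x -> forall n,
    (forall s m, G (mkseq (I x) s, n) = Some m -> m = T x n) /\
    exists s0, forall s, s0 <= s -> G (mkseq (I x) s, n)) ->
  ucomp D I T.
Proof.
move=> rG hG; exists (fun w => grow G w (size w)).
split; [exact: recu_grow|exact: grow_monotone|].
move=> x Dx; have grow_word s j : j <= s -> word_prefix (grow G (mkseq (I x) s) j) (T x).
  elim: j => //= j IH js; have := IH (ltnW js).
  set u := grow _ _ _; rewrite take_mkseq //; case E: (G _) => [m|] // up.
  rewrite (proj1 (hG x Dx _) _ _ E) /word_prefix size_rcons mkseqS.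
  by rewrite {1}up.
split=> [s|n]; first by rewrite size_mkseq; exact: grow_word.
elim: n => [|n [s0 IH]]; first by exists 0.
have [s1 hs1] := proj2 (hG x Dx n).
(* By time [t] the first [n] digits are written and [G] knows digit [n]; one more round appends
   it. *)
pose t := maxn s0 s1.
have ht : n < size (grow G (mkseq (I x) t.+1) t.+1).
  rewrite growS take_oversize ?size_mkseq //.
  have := IH t (leq_maxl _ _); rewrite size_mkseq.
  rewrite -(grow_take G (prefix_mkseq (I x) (leqnSn t))) ?size_mkseq //.
  set u := grow _ _ _; rewrite leq_eqVlt => /orP[/eqP e|nu].
    have : G (mkseq (I x) t.+1, n) by apply: hs1; rewrite leqW ?leq_maxr.
    by rewrite -e; case: (G _) => // m _; rewrite size_rcons -e.
  by case: (G _) => [m|] //; rewrite size_rcons ltnW.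
exists t.+1 => s ts; apply: leq_trans ht _; apply: size_prefix.
have -> : grow G (mkseq (I x) t.+1) t.+1 = grow G (mkseq (I x) s) t.+1.
  by rewrite (grow_take G (prefix_mkseq (I x) ts)) // size_mkseq.
by rewrite size_mkseq; exact: grow_homo.
Qed.

Lemma ucomp_id X (D : set X) I : ucomp D I I.
Proof.
exists id; split=> [|//|x Dx]; first exact: recu_id.
by split=> // n; exists n => s; rewrite size_mkseq.
Qed.

Lemma ucomp_sub X Y (D : set X) (E : set Y) I J T V (g : X -> Y) :
  ucomp E J V -> (forall x, D x -> [/\ E (g x), J (g x) = I x & V (g x) = T x]) ->
  ucomp D I T.
Proof.
move=> [phi [rphi mphi hphi]] h; exists phi; split=> // x Dx.
by have [Eg <- <-] := h x Dx; exact: hphi.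
Qed.

Lemma ucomp_comp X (D : set X) I A T : ucomp D I A -> ucomp D A T -> ucomp D I T.
Proof.
move=> [f [rf mf hf]] [g [rg mg hg]]; exists (fun w => g (f w)); split.
- by recu_auto.
- by move=> v w /mf /mg.
- move=> x Dx; have [f1 f2] := hf x Dx; have [g1 g2] := hg x Dx; split=> [s|n].
    by rewrite (f1 s).
  have [s0 h0] := g2 n; have [s1 h1] := f2 s0; exists s1 => s /h1 le.
  by rewrite (f1 s); exact: h0.
Qed.

Lemma ucomp_ext X (D : set X) I T T' :
  ucomp D I T -> (forall x, D x -> T x =1 T' x) -> ucomp D I T'.
Proof.
by move=> h e; apply: (ucomp_sub (g := id) h) => x Dx; split=> //; apply/funext; exact: e.
Qed.

Lemma ucomp_recu X (D : set X) I (h : nat -> nat) : recu h -> ucomp D I (fun=> h).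
Proof.
move=> rh; apply: (@ucomp_digits _ _ _ _ (fun y => Some (h y.2))); first by recu_auto.
by move=> x _ n; split=> [s m [<-]|]; last by exists 0.
Qed.

Lemma onth_approx (phi : seq nat -> seq nat) (p q : baire) n :
  (forall s, word_prefix (phi (mkseq p s)) q) ->
  (forall n, exists s0, forall s, s0 <= s -> n <= size (phi (mkseq p s))) ->
  (forall s m, onth (phi (mkseq p s)) n = Some m -> m = q n) /\
  exists s0, forall s, s0 <= s -> onth (phi (mkseq p s)) n.
Proof.
move=> h1 h2; split=> [s m|]; first exact: onth_word.
by have [s0 h0] := h2 n.+1; exists s0 => s /h0; rewrite onthTE.
Qed.

Lemma ucomp_bpair X (D : set X) I A B :
  ucomp D I A -> ucomp D I B -> ucomp D I (fun x => bpair (A x) (B x)).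
Proof.
move=> [f [rf mf hf]] [g [rg mg hg]].
apply: (@ucomp_digits _ _ _ _ (fun y =>
  if odd y.2 then onth (g y.1) y.2./2 else onth (f y.1) y.2./2)).
  by recu_auto.
move=> x Dx n; have [f1 f2] := hf x Dx; have [g1 g2] := hg x Dx.
by rewrite /bpair /=; case: (odd n); exact: onth_approx.
Qed.

(** A number that depends on the input is passed around as a constant sequence, so that [ucomp]
    applies to it. *)
Definition cst (n : nat) : baire := fun=> n.

Lemma ucomp_local X (D : set X) I (M : X -> nat) A (b : nat * nat -> nat)
    (h : nat * nat * seq nat -> nat) :
  recu b -> recu h -> ucomp D I (fun x => cst (M x)) -> ucomp D I A ->
  ucomp D I (fun x n => h (M x, n, mkseq (A x) (b (M x, n)))).
Proof.
move=> rb rh [f [rf mf hf]] [g [rg mg hg]].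
apply: (@ucomp_digits _ _ _ _ (fun y =>
  if onth (f y.1) 0 is Some m then
    if b (m, y.2) <= size (g y.1) then
      Some (h (m, y.2, take (b (m, y.2)) (g y.1)))
    else None
  else None)).
  by recu_auto.
move=> x Dx n; have [f1 f2] := hf x Dx; have [g1 g2] := hg x Dx.
have [e1 [s1 h1]] := onth_approx 0 f1 f2; have [s2 h2] := g2 (b (M x, n)).
split=> [s m|]; cbn [fst snd].
  case E: (onth (_ : seq nat) 0) => [k|] //; rewrite (e1 _ _ E) /cst; case: ifP => // le [<-].
  by rewrite (g1 s) take_mkseq.
exists (maxn s1 s2) => s; rewrite geq_max => /andP[/h1 i1 /h2 i2].
case E: (onth (_ : seq nat) 0) i1 => [k|] // _.
by rewrite (e1 _ _ E) /cst i2.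
Qed.

Lemma ucomp_local0 X (D : set X) I A (b : nat -> nat) (h : nat * seq nat -> nat) :
  recu b -> recu h -> ucomp D I A ->
  ucomp D I (fun x n => h (n, mkseq (A x) (b n))).
Proof.
move=> rb rh uA.
apply: (@ucomp_local _ D I (fun=> 0) A (fun y => b y.2) (fun y => h (y.1.2, y.2))).
- by recu_auto.
- by recu_auto.
- by apply: ucomp_recu; exact: recu_const.
- exact: uA.
Qed.

(** Each branch need only be computable where it is chosen; this permits branches that call [U]
    outside whose domain nothing is known. *)
Lemma ucomp_if0 X (D : set X) I (N : X -> nat) A B :
  ucomp D I (fun x => cst (N x)) ->
  ucomp [set x | D x /\ N x = 0]%classic I A ->
  ucomp [set x | D x /\ N x <> 0]%classic I B ->
  ucomp D I (fun x => if N x == 0 then A x else B x).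
Proof.
move=> [e [re me he]] [f [rf mf hf]] [g [rg mg hg]].
apply: (@ucomp_digits _ _ _ _ (fun y =>
  if onth (e y.1) 0 is Some m then
    if m == 0 then onth (f y.1) y.2 else onth (g y.1) y.2
  else None)).
  by recu_auto.
move=> x Dx n; have [e1 e2] := he x Dx; have [i1 [s1 h1]] := onth_approx 0 e1 e2.
have [phi [p1 p2 ephi]] : exists phi, [/\
    forall s, word_prefix (phi (mkseq (I x) s)) (if N x == 0 then A x else B x),
    forall n, exists s0, forall s, s0 <= s -> n <= size (phi (mkseq (I x) s)) &
    forall y : seq nat * nat, (if N x == 0 then onth (f y.1) y.2 else onth (g y.1) y.2)
      = onth (phi y.1) y.2].
  case: eqP => N0; first by exists f; have [] := hf x (conj Dx N0).
  by exists g; have [] := hg x (conj Dx N0).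
have [j1 [s2 h2]] := onth_approx n p1 p2.
split=> [s m|]; cbn [fst snd].
  case E: (onth (_ : seq nat) 0) => [k|] //; rewrite (i1 _ _ E) /cst (ephi (_, _)).
  exact: j1.
exists (maxn s1 s2) => s; rewrite geq_max => /andP[/h1 l1 /h2 l2].
case E: (onth (_ : seq nat) 0) l1 => [k|] // _.
by rewrite (i1 _ _ E) /cst (ephi (_, _)).
Qed.

Definition consb (n : nat) (p : baire) : baire := fun k => if k is k'.+1 then p k' else n.

Lemma mkseq_consb n p s : mkseq (consb n p) s.+1 = n :: mkseq p s.
Proof. by rewrite /mkseq /= (iotaDl 1 0) -map_comp. Qed.

(** The index enters as an extra first digit of the input, so that one word function serves all
    components. *)
Lemma ucomp_btuple X (D : set X) I (T : X -> nat -> baire) :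
  ucomp [set y : X * nat | D y.1]%classic (fun y => consb y.2 (I y.1))
    (fun y => T y.1 y.2) ->
  ucomp D I (fun x => btuple (T x)).
Proof.
move=> [f [rf mf hf]].
apply: (@ucomp_digits _ _ _ _ (fun y =>
  onth (f ((Cantor.of_nat y.2).1 :: y.1)) (Cantor.of_nat y.2).2)).
  by recu_auto.
move=> x Dx n; rewrite /btuple /=; case: (Cantor.of_nat n) => i j /=.
have [f1 f2] := hf (x, i) Dx; have [e1 [s0 h0]] := onth_approx j f1 f2.
split=> [s m|].
  by rewrite -mkseq_consb; exact: e1.
by exists s0 => s /leqW /h0; rewrite mkseq_consb.
Qed.

Lemma ucomp_evens X (D : set X) I A : ucomp D I A -> ucomp D I (fun x => evens (A x)).
Proof.
move=> uA; apply: (ucomp_ext (ucomp_local0 (b := fun n => n.*2.+1)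
  (h := fun y => nth 0 y.2 y.1.*2) _ _ uA)); [by recu_auto..|].
by move=> x _ n; cbn [fst snd]; rewrite nth_mkseq.
Qed.

Lemma ucomp_odds X (D : set X) I A : ucomp D I A -> ucomp D I (fun x => odds (A x)).
Proof.
move=> uA; apply: (ucomp_ext (ucomp_local0 (b := fun n => n.*2.+2)
  (h := fun y => nth 0 y.2 y.1.*2.+1) _ _ uA)); [by recu_auto..|].
by move=> x _ n; cbn [fst snd]; rewrite nth_mkseq.
Qed.

Definition tailb (p : baire) : baire := fun n => p n.+1.

Lemma tailb_consb n p : tailb (consb n p) = p. Proof. by []. Qed.

Lemma ucomp_tailb X (D : set X) I A : ucomp D I A -> ucomp D I (fun x => tailb (A x)).
Proof.
move=> uA; apply: (ucomp_ext (ucomp_local0 (b := fun n => n.+2)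
  (h := fun y => nth 0 y.2 y.1.+1) _ _ uA)); [by recu_auto..|].
by move=> x _ n; cbn [fst snd]; rewrite nth_mkseq.
Qed.

Lemma ucomp_consb X (D : set X) I (N : X -> nat) A :
  ucomp D I (fun x => cst (N x)) -> ucomp D I A -> ucomp D I (fun x => consb (N x) (A x)).
Proof.
move=> uN uA; apply: (ucomp_ext (ucomp_local (b := fun y => y.2)
  (h := fun y => if y.1.2 == 0 then y.1.1 else nth 0 y.2 y.1.2.-1) _ _ uN uA)).
- by recu_auto.
- by recu_auto.
- by move=> x _ [|n] //; cbn [fst snd]; rewrite nth_mkseq.
Qed.

Lemma ucomp_bproj X (D : set X) I (N : X -> nat) A :
  ucomp D I (fun x => cst (N x)) -> ucomp D I A ->
  ucomp D I (fun x => bproj (A x) (N x)).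
Proof.
move=> uN uA; apply: (ucomp_ext (ucomp_local (b := fun y => (Cantor.to_nat (y.1, y.2)).+1)
  (h := fun y => nth 0 y.2 (Cantor.to_nat (y.1.1, y.1.2))) _ _ uN uA)).
- by recu_auto.
- by recu_auto.
- by move=> x _ n; cbn [fst snd]; rewrite nth_mkseq.
Qed.

Lemma ucomp_cst X (D : set X) I c : ucomp D I (fun=> cst c).
Proof. by apply: ucomp_recu; exact: recu_const. Qed.

Lemma ucomp_digit X (D : set X) I A k :
  ucomp D I A -> ucomp D I (fun x => cst (A x k)).
Proof.
move=> uA; apply: (ucomp_ext (ucomp_local0 (b := fun n => k.+1)
  (h := fun y => nth 0 y.2 k) _ _ uA)); [by recu_auto..|].
by move=> x _ n; cbn [fst snd]; rewrite nth_mkseq.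
Qed.

Lemma ucomp_cst_local X (D : set X) I (M : X -> nat) A (b : nat -> nat)
    (h : nat * seq nat -> nat) :
  recu b -> recu h -> ucomp D I (fun x => cst (M x)) -> ucomp D I A ->
  ucomp D I (fun x => cst (h (M x, mkseq (A x) (b (M x))))).
Proof.
move=> rb rh uM uA.
apply: (@ucomp_local _ D I M A (fun y => b y.1) (fun y => h (y.1.1, y.2))) => //;
  by recu_auto.
Qed.

Lemma ucomp_cst_recu X (D : set X) I (M : X -> nat) (h : nat -> nat) :
  recu h -> ucomp D I (fun x => cst (M x)) -> ucomp D I (fun x => cst (h (M x))).
Proof.
move=> rh uM; apply: (@ucomp_cst_local _ D I M (fun=> cst 0) (fun=> 0) (fun y => h y.1)) => //.
- by recu_auto.
- by recu_auto.
- exact: ucomp_cst.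
Qed.

(** * The universal function is computable *)

Definition U_entry (y : seq nat * nat) (k : nat) : option nat :=
  if 2 < nth 0 y.1 k.*2 then
    if (size (CodeSeq.decode (Cantor.of_nat (nth 0 y.1 k.*2 - 3)).1) <= (size y.1)./2) &&
       (CodeSeq.decode (Cantor.of_nat (nth 0 y.1 k.*2 - 3)).1 ==
        mkseq (fun i => nth 0 y.1 i.*2.+1)
          (size (CodeSeq.decode (Cantor.of_nat (nth 0 y.1 k.*2 - 3)).1)))
    then onth (CodeSeq.decode (Cantor.of_nat (nth 0 y.1 k.*2 - 3)).2) y.2
    else None
  else None.

Definition U_digit (y : seq nat * nat) : option nat :=
  nat_rect (fun=> option nat) None
    (fun k r => if r is Some m then Some m else U_entry y k) (size y.1)./2.

Lemma recu_U_digit : recu U_digit.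
Proof.
rewrite /U_digit /U_entry; recu_auto.
Qed.

Lemma U_entryP t s n k m : k < s./2 ->
  (U_entry (mkseq t s, n) k = Some m <->
   exists v w, [/\ evens t k = (Cantor.to_nat (CodeSeq.code v, CodeSeq.code w)).+3,
     word_prefix v (odds t), size v <= s./2 & onth w n = Some m]).
Proof.
move=> ks; rewrite /U_entry; cbn [fst snd]; rewrite size_mkseq nth_mkseq; last by lia.
have om j : j <= s./2 -> mkseq (fun i => nth 0 (mkseq t s) i.*2.+1) j = mkseq (odds t) j.
  move=> js; apply/eq_in_map => i; rewrite mem_iota add0n => ij.
  by rewrite nth_mkseq //; lia.
split.
  case: ltnP => // lt; case: ifP => // /andP[sv /eqP ev] ew.
  eexists; eexists; split; last exact: ew; last exact: sv.
    rewrite !CodeSeq.decodeK -surjective_pairing Cantor.cancel_to_of /evens; lia.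
  by rewrite /word_prefix {1}ev om.
move=> [v [w [e vt sv ew]]]; rewrite -/(evens t k) e [2 < _]/= !subSS subn0.
by rewrite Cantor.cancel_of_to !CodeSeq.codeK sv om // -vt eqxx.
Qed.

(** Where [U] is defined, all entries of the name whose input word is a prefix of the argument have
    compatible outputs, so the first one that supplies a digit can be trusted. *)
Lemma ucomp_U X (D : set X) I A B :
  ucomp D I A -> (forall x, D x -> U (A x) (B x)) -> ucomp D I B.
Proof.
move=> uA hU; apply: ucomp_comp uA _; apply: ucomp_digits recu_U_digit _ => x Dx n.
have [h1 h2] := hU x Dx; split=> [s m|].
  rewrite /U_digit; cbn [fst snd]; rewrite size_mkseq.
  elim: {-2}(s./2) (leqnn s./2) => //= k IH ks; move: (IH (ltnW ks)).
  case: (nat_rect _ _ _ _) => [m'|_]; first exact.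
  move=> /(U_entryP _ _ _ ks)[v [w [e vt _ ew]]].
  by apply: onth_word ew; apply: h1; exists v => //; exists k.
have [w [v vt [k e]] nw] := h2 n.+1.
(* Long enough for the even half to contain entry [k] and the odd half to contain [v]. *)
exists (k + size v).+1.*2 => s hs; rewrite /U_digit; cbn [fst snd]; rewrite size_mkseq.
have [m em] : exists m, onth w n = Some m.
  by have : onth w n; [rewrite onthTE|case: (onth w n) => // m _; exists m].
have : k < s./2 by lia.
elim: (s./2) {-2}(s./2) (leqnn s./2) => [|j IH] i ij //= ki.
  by case: i ij ki.
case: i ij ki => //= i ij ki; case E: (nat_rect _ _ _ _) => [//|].
have [ik|ik] : k < i \/ k = i by lia.
  by have := IH i ij ik; rewrite E.
have ks : k < s./2 by lia.
rewrite -ik; suff -> : U_entry (mkseq (A x) s, n) k = Some m by [].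
apply/(U_entryP _ _ _ ks); exists v, w; split=> //.
lia.
Qed.

(** * Names of computable functions *)

(** Reads the parameter back from the odd digits of [smn_name]; the 3 is the shift past the dummy
    digits. *)
Definition name_arg (t : baire) : baire := fun n => (Cantor.of_nat (t n.*2.+1 - 3)).1.

Lemma ucomp_name_arg X (D : set X) I A :
  ucomp D I A -> ucomp D I (fun x => name_arg (A x)).
Proof.
move=> uA; apply: (ucomp_ext (ucomp_local0 (b := fun n => n.*2.+2)
  (h := fun y => (Cantor.of_nat (nth 0 y.2 y.1.*2.+1 - 3)).1) _ _ uA)); [by recu_auto..|].
by move=> x _ n; cbn [fst snd]; rewrite nth_mkseq.
Qed.

(* The odd digits [(v, [::])] do not change the named function; they store the
   parameter [y], so that it can be read off from its name. *)
Definition smn_name (phi : seq nat -> seq nat) (y : baire) : baire := fun n =>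
  if odd n then (Cantor.to_nat (y n./2, 0)).+3
  else (Cantor.to_nat (n./2, CodeSeq.code (phi (mkseq
    (bpair y (nth 0 (CodeSeq.decode n./2))) (size (CodeSeq.decode n./2)).*2)))).+3.

Lemma ucomp_smn_name phi : recu phi ->
  ucomp (@setT baire) id (smn_name phi).
Proof.
move=> rphi.
pose b n := n + size (CodeSeq.decode n./2).
pose h (y : nat * seq nat) :=
  if odd y.1 then (Cantor.to_nat (nth 0 y.2 y.1./2, 0)).+3
  else (Cantor.to_nat (y.1./2, CodeSeq.code (phi (mkseq
    (fun i => if odd i then nth 0 (CodeSeq.decode y.1./2) i./2 else nth 0 y.2 i./2)
    (size (CodeSeq.decode y.1./2)).*2)))).+3.
have rb : recu b by rewrite /b; recu_auto.
have rh : recu h by rewrite /h; recu_auto.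
apply: (ucomp_ext (ucomp_local0 rb rh (ucomp_id _ _))) => y _ n.
rewrite /h /smn_name /b; cbn [fst snd]; case: ifP => on.
  by rewrite nth_mkseq //; lia.
congr (Cantor.to_nat (_, CodeSeq.code (phi _))).+3.
apply/eq_in_map => i; rewrite mem_iota add0n /bpair => hi; case: ifP => // oi.
by rewrite nth_mkseq //; lia.
Qed.

(** The nonzero first digit ensures that a state headed by such a name is not taken for the end of a
    run of [diamond]. *)
Lemma smn X (D : set X) q p T :
  ucomp D (fun x => bpair (q x) (p x)) T ->
  exists S : baire -> baire, [/\ ucomp setT id S, forall y, name_arg (S y) = y,
    forall y, S y 0 != 0 & forall x, D x -> U (bpair (S (q x)) (p x)) (T x)].
Proof.
move=> [phi [rphi mphi hphi]]; exists (smn_name phi); split.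
- exact: ucomp_smn_name.
- move=> y; apply/funext => n; rewrite /name_arg /smn_name.
  have -> : odd n.*2.+1 by rewrite /= odd_double.
  have -> : n.*2.+1./2 = n by rewrite /= uphalf_double.
  by rewrite !subSS subn0 Cantor.cancel_of_to.
- by [].
move=> x Dx; have [h1 h2] := hphi x Dx; rewrite /U /Phi evens_bpair odds_bpair.
have on_word v : word_prefix v (p x) ->
    mkseq (bpair (q x) (nth 0 v)) (size v).*2 = mkseq (bpair (q x) (p x)) (size v).*2.
  move=> vp; apply/eq_in_map => i; rewrite mem_iota add0n /bpair => hi.
  by case: ifP => // oi; rewrite (word_prefix_nth vp) //; lia.
have inj3 a b c d : (Cantor.to_nat (a, b)).+3 = (Cantor.to_nat (c, d)).+3 ->
    a = c /\ b = d.
  by move=> e; case: (Cantor.to_nat_inj _ _ (succn_inj (succn_inj (succn_inj e)))).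
split=> [w [v vp [k]]|n].
  rewrite /smn_name; case: ifP => ok /inj3[e1 e2].
    by have -> : w = [::] by apply: (can_inj CodeSeq.codeK); rewrite -e2.
  have := can_inj CodeSeq.codeK e2; rewrite e1 CodeSeq.codeK on_word // => <-.
  exact: h1.
have [s0 hs] := h2 n; pose v := mkseq (p x) s0.
exists (phi (mkseq (bpair (q x) (p x)) s0.*2)); last by apply: hs; lia.
exists v; first exact: word_prefix_mkseq.
exists (CodeSeq.code v).*2; rewrite /smn_name odd_double doubleK CodeSeq.codeK.
by rewrite on_word ?size_mkseq //; exact: word_prefix_mkseq.
Qed.

Definition zerob : baire := cst 0.

(* [SV (bpair c y)] names the function that applies the program [c] to its own
   name [c], to [y] and to the argument; so [c] can refer to [SV (bpair c _)]. *)
Lemma recursion_theorem : exists SV : baire -> baire,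
  [/\ ucomp setT id SV, forall y, name_arg (SV y) = y, forall y, SV y 0 != 0 &
    forall X (D : set X) (q r : X -> baire) (T : baire -> X -> baire),
      ucomp [set y : baire * X | D y.2]%classic
        (fun y => bpair (bpair y.1 (q y.2)) (r y.2)) (fun y => T y.1 y.2) ->
      exists c, (forall Y (E : set Y) J, ucomp E J (fun=> c)) /\
        forall x, D x -> U (bpair (SV (bpair c (q x))) (r x)) (T c x)].
Proof.
pose DV (y : (baire * baire) * (baire * baire)) :=
  U (bpair y.1.1 (bpair (bpair y.1.1 y.1.2) y.2.1)) y.2.2.
have [|SV [uSV SVK SV0 hSV]] :=
  @smn _ DV (fun y => bpair y.1.1 y.1.2) (fun y => y.2.1) (fun y => y.2.2).
  set I := (fun y => bpair _ _); have uI : ucomp DV I I by exact: ucomp_id.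
  have uc : ucomp DV I (fun y => y.1.1).
    apply: ucomp_ext (ucomp_evens (ucomp_evens uI)) _ => y _ n.
    by rewrite !evens_bpair.
  by apply: ucomp_U (ucomp_bpair uc uI) _ => y.
exists SV; split=> // X D q r T uT.
have [|S [uS _ _ hS]] := @smn _ [set y : baire * X | D y.2]%classic (fun=> zerob)
    (fun y => bpair (bpair y.1 (q y.2)) (r y.2)) (fun y => T y.1 y.2).
  apply: ucomp_comp uT; apply: ucomp_ext (ucomp_odds (ucomp_id _ _)) _ => y _ n.
  by rewrite odds_bpair.
(* The constant parameter [zerob] is computable, which makes the program a single computable
   name. *)
exists (S zerob); split=> [Y E J|x Dx].
  by apply: ucomp_comp (ucomp_cst _ _ 0) _; apply: (ucomp_sub (g := fun=> zerob) uS).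
apply: (hSV ((S zerob, q x), (r x, T (S zerob) x))).
exact: (hS (S zerob, x) Dx).
Qed.

(** [F] is the function approximated by the word function with its largest domain: it is defined
    wherever the supremum is an infinite word. *)
Lemma ucomp_computable X (D : set X) I T : ucomp D I T ->
  exists F, computable F /\ forall x, D x -> F (I x) = Some (T x).
Proof.
move=> [phi [rphi mphi hphi]].
pose R p q := is_sup [set phi w | w in [set w | word_prefix w p]]%classic q.
pose F p := if pselect (exists q, R p q) is left e then Some (projT1 (cid e)) else None.
have FR p q : F p = Some q -> R p q.
  by rewrite /F; case: pselect => // e [<-]; exact: projT2 (cid e).
exists F; split; first by exists phi; split=> //; exact/recuP.
move=> x Dx; have Rx : R (I x) (T x) by apply/is_supP => //; exact: hphi.
rewrite /F; case: pselect => [e|[]]; last by exists (T x).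
by congr Some; apply: is_sup_unique Rx; exact: projT2 (cid e).
Qed.

Lemma computable_ucomp F : computable F ->
  ucomp [set y : baire * baire | F y.1 = Some y.2]%classic fst snd.
Proof.
move=> [phi [/recuP rphi mphi h]]; exists phi; split=> // -[p q] /= /h.
by move=> /is_supP; exact.
Qed.

(** * Unbounded search *)

(** Pairs of a segment length and a candidate are tested in the order of their codes. Taking the
    least successful code makes the result independent of how much of [p] has been read. *)
Lemma search_witness (R : seq nat * nat -> bool) : recu R ->
  exists N : baire -> nat,
    ucomp [set p | exists s z, R (mkseq p s, z)]%classic id (fun p => cst (N p)) /\
    forall p, (exists s z, R (mkseq p s, z)) -> exists s, R (mkseq p s, N p).
Proof.
move=> rR.
pose test (p : baire) j := R (mkseq p (Cantor.of_nat j).1, (Cantor.of_nat j).2).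
have ex p : (exists s z, R (mkseq p s, z)) -> exists j, test p j.
  move=> [s [z Rsz]]; exists (Cantor.to_nat (s, z)).
  by rewrite /test Cantor.cancel_of_to.
pose N p := if pselect (exists j, test p j) is left e
  then (Cantor.of_nat (ex_minn e)).2 else 0.
exists N; split; last first.
  move=> p /ex e; rewrite /N; case: pselect => // e'.
  by case: ex_minnP => j tj _; exists (Cantor.of_nat j).1.
pose first (w : seq nat) := nat_rect (fun=> option nat) None
  (fun k r => if r is Some m then Some m else
     if R (take (Cantor.of_nat k).1 w, (Cantor.of_nat k).2) then Some (Cantor.of_nat k).2
     else None) (size w).+1.
apply: (@ucomp_digits _ _ _ _ (fun y => first y.1)); first by rewrite /first; recu_auto.
move=> p /ex e n; rewrite /N; case: pselect => // e'; case: ex_minnP => j tj jmin.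
pose val j := (Cantor.of_nat j).2.
have firstP s : first (mkseq p s) = if j <= s then Some (val j) else None.
  rewrite /first size_mkseq -[j <= s]ltnS.
  elim: {-2}s.+1 (leqnn s.+1) => // k IH ks.
  rewrite [LHS]/= (IH (ltnW ks)).
  case: (ltnP j k) => jk; first by rewrite ltnS (ltnW jk).
  (* The code of a pair is at least its first component, so the segment that test [k] asks for has
     already been read. *)
  rewrite take_mkseq; last first.
    have := Cantor.to_nat_non_decreasing (Cantor.of_nat k).1 (Cantor.of_nat k).2.
    by rewrite -surjective_pairing Cantor.cancel_to_of; lia.
  rewrite -/(test p k) ltnS; case: (ltngtP j k) jk => // [kj|<-] _; last by rewrite tj.
  by case: ifP => // /jmin; rewrite leqNgt kj.
split=> [s m|].
  by rewrite firstP; case: ifP => // _ [<-].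
by exists j => s js; rewrite firstP js.
Qed.

(** * Prepending words and Turing degrees *)

Definition catw (w : seq nat) (r : baire) : baire :=
  fun k => if k < size w then nth 0 w k else r (k - size w).

Lemma ucomp_catw X (D : set X) I (M : X -> nat) (h : nat -> seq nat) A :
  recu h -> ucomp D I (fun x => cst (M x)) -> ucomp D I A ->
  ucomp D I (fun x => catw (h (M x)) (A x)).
Proof.
move=> rh uM uA.
apply: (ucomp_ext (ucomp_local (b := fun y => y.2.+1) (h := fun y =>
  if y.1.2 < size (h y.1.1) then nth 0 (h y.1.1) y.1.2
  else nth 0 y.2 (y.1.2 - size (h y.1.1))) _ _ uM uA)).
- by recu_auto.
- by recu_auto.
- move=> x _ n; cbn [fst snd]; rewrite /catw; case: ifP => // _.
  by rewrite nth_mkseq // ltnS leq_subr.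
Qed.

Lemma turing_leP q p :
  turing_le q p <-> ucomp (@setT unit) (fun=> p) (fun=> q).
Proof.
split=> [[F [cF Fp]]|/ucomp_computable[F [cF Fp]]].
  exact: (ucomp_sub (g := fun=> (p, q)) (computable_ucomp cF)).
by exists F; split=> //; exact: Fp tt I.
Qed.

Lemma turing_le_trans q p r : turing_le r q -> turing_le q p -> turing_le r p.
Proof.
by move=> /turing_leP rq /turing_leP qp; apply/turing_leP; exact: ucomp_comp qp rq.
Qed.

Lemma turing_equiv_catw w r : turing_equiv (catw w r) r.
Proof.
split; apply/turing_leP.
  apply: (@ucomp_catw _ _ _ (fun=> 0) (fun=> w)); first exact: recu_const.
    exact: ucomp_cst.
  exact: ucomp_id.
apply: (ucomp_ext (ucomp_local0 (b := fun n => (n + size w).+1)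
  (h := fun y => nth 0 y.2 (y.1 + size w)) _ _ (ucomp_id _ _))).
- by recu_auto.
- by recu_auto.
- move=> _ _ n; cbn [fst snd]; rewrite nth_mkseq // /catw ifF ?addnK //.
  by rewrite ltnNge leq_addl.
Qed.

Lemma degree_catw w r : degree (catw w r) = degree r.
Proof.
have [h1 h2] := turing_equiv_catw w r.
by apply/seteqP; split=> q [q1 q2]; split; apply: turing_le_trans; eassumption.
Qed.

(** This is all that is used of Turing degrees as opposed to other represented spaces. *)
Lemma realizer_version_catw (f : multifun Degrees Degrees) p r w :
  realizer_version f p r -> realizer_version f p (catw w r).
Proof.
move=> [h [y fy yr]]; split=> //; exists y => //.
by rewrite /rep_inv /= degree_catw.
Qed.

(** * Runs and finite powers *)

Lemma U_unique t p q : U t p -> U t q -> p = q.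
Proof. exact: is_sup_unique. Qed.

(** [U] is single-valued, so one value of [U] for each answer describes all successors. *)
Lemma run_step_all g q P : mdom g (odds q) ->
  (forall r, g (odds q) r -> exists2 t, U (bpair (evens q) r) t & P t) ->
  mdom (run_step g) q /\ forall q', run_step g q q' -> P q'.
Proof.
move=> [r0 gr0] h; split.
  have [t ht _] := h r0 gr0; exists t; split; last first.
    by exists (bpair (evens q) r0) => //; exists r0.
  by move=> _ [r gr <-]; have [t' ht' _] := h r gr; exists t'.
move=> q' [_ [_ [r gr <-] Uq']]; have [t ht Pt] := h r gr.
by rewrite (U_unique Uq' ht).
Qed.

Lemma run_step_dom g q : mdom (run_step g) q ->
  mdom g (odds q) /\
  forall r, g (odds q) r -> exists2 t, U (bpair (evens q) r) t & run_step g q t.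
Proof.
move=> [q' [h [_ [r gr <-] Uq']]]; split; first by exists r.
move=> r' gr'; have [t ht] : mdom U (bpair (evens q) r') by apply: h; exists r'.
by exists t => //; split=> //; exists (bpair (evens q) r') => //; exists r'.
Qed.

(** [P i] is an invariant of the states after [i] steps. It forces every run to continue before step
    [N] and to halt there, which excludes stalling and infinite runs. *)
Lemma diamond_inv g q0 N (P : nat -> baire -> Prop) : P 0 q0 ->
  (forall i q, i < N -> P i q -> [/\ q 0 <> 0, mdom (run_step g) q &
    forall q', run_step g q q' -> P i.+1 q']) ->
  (forall q, P N q -> q 0 = 0) ->
  mdom (diamond g) q0 /\ forall y, diamond g q0 y -> P N y.
Proof.
move=> P0 PS PN.
have run Q k : Q 0 = q0 -> (forall i, i < k -> run_step g (Q i) (Q i.+1)) ->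
    k <= N -> P k (Q k).
  move=> Q0; elim: k => [|k IH] hQ kN; first by rewrite Q0.
  have [|_ _ h] := PS k (Q k) kN; first by apply: IH => [i ik|]; [apply: hQ; lia|lia].
  exact/h/hQ.
split; last first.
  move=> _ [_ [Q [k [Q0 [h1 h2 h3] ->]]]].
  have [kN|Nk] := leqP k N; last first.
    case: (h3 N Nk); apply/PN/run => // i iN; apply: h1; lia.
  have := run Q k Q0 h1 kN; case: (ltngtP k N) kN => // [kN _ Pk|-> //].
  by have [] := PS k (Q k) kN Pk.
(* A choice of successors yields one successful run, for the existence of a result. *)
pose s q := if pselect (mdom (run_step g) q) is left e then projT1 (cid e) else q.
have sP q : mdom (run_step g) q -> run_step g q (s q).
  by move=> dq; rewrite /s; case: pselect => // e; exact: projT2 (cid e).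
pose Q i := iter i s q0.
have QP i : i <= N -> P i (Q i).
  elim: i => [//|i IH] iN; have [_ /sP h1 h2] := PS i (Q i) iN (IH (ltnW iN)).
  exact: h2.
exists (Q N); split.
  move=> R R0; split=> [k [h1 h2 h3]|[h1 h2]].
    have [Nk|kN] := leqP N k.
      by apply: (h3 N Nk); apply/PN/run => // i iN; apply: h1; lia.
    by apply: h2; have [] := PS k (R k) kN (run R k R0 h1 (ltnW kN)).
  by apply: (h2 N); apply/PN/run => // i iN.
exists Q, N; split=> //; split.
- by move=> i iN; apply: sP; have [] := PS i (Q i) iN (QP i (ltnW iN)).
- exact: PN (QP N _).
- by move=> i iN; have [] := PS i (Q i) iN (QP i (ltnW iN)).
Qed.

(** The inputs of the call that follows [n] completed rounds. They turn the two base cases of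
    [fin_power] into the uniform recursion [fin_powerS]. *)
Definition query_states g n : multifun Baire Baire :=
  if n is n'.+1 then mcomp U (fin_power g n'.+1) else @mid Baire.

Lemma fin_powerS g n : fin_power g n.+1 = mcomp (id_times g) (query_states g n).
Proof.
case: n => [|n] //=; apply/funext => p; apply/seteqP; split=> [y hy|y [_ [_ -> hy]]] //.
by split=> [_ ->|]; [exists y|exists p].
Qed.

Lemma fin_power_dom_le g p m n : m <= n ->
  mdom (fin_power g n.+1) p -> mdom (fin_power g m.+1) p.
Proof.
move=> /subnK <-; elim: (n - m) => [//|k IH] h; apply: IH.
by have [y [_ [t [_ [u hu _]] _]]] := h; exists u.
Qed.

Lemma query_states_dom g p n t : mdom (fin_power g n.+1) p ->
  query_states g n p t -> mdom g (odds t).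
Proof.
rewrite fin_powerS => -[y [h _]] ht; have [_ [r gr _]] := h t ht; by exists r.
Qed.

Lemma fin_powerS_intro g p n t r : mdom (fin_power g n.+1) p ->
  query_states g n p t -> g (odds t) r -> fin_power g n.+1 p (bpair (evens t) r).
Proof.
by rewrite fin_powerS => -[y [h _]] ht gr; split=> //; exists t => //; exists r.
Qed.

Lemma query_states_step g p n y : mdom (fin_power g n.+2) p ->
  fin_power g n.+1 p y ->
  mdom U y /\ forall t, U y t -> query_states g n.+1 p t.
Proof.
move=> [z [_ [t [h _] _]]] hy; split; first exact: h.
by move=> t' Ut'; split=> //; exists y.
Qed.

(** Counterpart of [diamond_inv]. The last answer is not yet processed by [U], so a result consists
    of an invariant state and an answer. *)
Lemma fin_power_inv g p (J : nat -> baire -> Prop) n : J 0 p ->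
  (forall i t, i <= n -> J i t -> mdom g (odds t)) ->
  (forall i t r, i < n -> J i t -> g (odds t) r ->
    exists2 t', U (bpair (evens t) r) t' & J i.+1 t') ->
  mdom (fin_power g n.+1) p /\ forall y, fin_power g n.+1 p y ->
    exists t r, [/\ J n t, g (odds t) r & y = bpair (evens t) r].
Proof.
move=> J0; elim: n => [|n IH] Jdom Jstep.
  split; first by have [r gr] := Jdom 0 p (leqnn _) J0; exists (bpair (evens p) r), r.
  by move=> _ [r gr <-]; exists p, r.
have [|i t r iN|[y0 hy0] hy] := IH.
- by move=> i t iN; apply: Jdom; lia.
- by apply: Jstep; lia.
have next y : fin_power g n.+1 p y -> exists2 t, U y t & J n.+1 t.
  by move=> /hy[t [r [Jt gr ->]]]; exact: Jstep Jt gr.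
have states t : query_states g n.+1 p t -> J n.+1 t.
  by move=> [_ [y /next[t' Ut' Jt'] Ut]]; rewrite (U_unique Ut Ut').
have sub : (fin_power g n.+1 p `<=` mdom U)%classic by move=> y /next[t Ut _]; exists t.
rewrite fin_powerS; split; last first.
  by move=> _ [_ [t /states Jt [r gr <-]]]; exists t, r.
have [t0 Ut0 Jt0] := next y0 hy0; have [r0 gr0] := Jdom _ _ (leqnn _) Jt0.
exists (bpair (evens t0) r0); split; last first.
  by exists t0; [split=> //; exists y0|exists r0].
move=> t /states/Jdom -/(_ (leqnn _))[r gr]; by exists (bpair (evens t) r), r.
Qed.

(** * From finite powers to diamond *)

(** [n] is kept for the output, which must repeat the index of the coproduct; the second digit
    counts down; [e] is the program of the simulated loop. The 0 put in front of the output is the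
    halting signal of [diamond]. *)
Lemma for_loop_machine : exists (SV : baire -> baire) (c : baire),
  [/\ ucomp setT id SV, forall Y (E : set Y) J, ucomp E J (fun=> c),
    forall y, SV y 0 <> 0,
    forall n e r, U (bpair (SV (bpair c (consb n (consb 0 e)))) r)
      (consb 0 (bpair (cst n) (bpair e r))) &
    forall n m e r t, U (bpair e r) t ->
      U (bpair (SV (bpair c (consb n (consb m.+1 e)))) r)
        (bpair (SV (bpair c (consb n (consb m (evens t))))) (odds t))].
Proof.
have [SV [uSV _ SV0 hSV]] := recursion_theorem; exists SV.
pose X := ((nat * nat) * (baire * baire * baire))%type.
pose D := [set x : X | x.1.2 <> 0 -> U (bpair x.2.1.1 x.2.1.2) x.2.2]%classic.
pose T (c : baire) (x : X) := if x.1.2 == 0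
  then consb 0 (bpair (cst x.1.1) (bpair x.2.1.1 x.2.1.2))
  else bpair (SV (bpair c (consb x.1.1 (consb x.1.2.-1 (evens x.2.2))))) (odds x.2.2).
have [|c [uc hc]] := @hSV X D (fun x => consb x.1.1 (consb x.1.2 x.2.1.1))
    (fun x => x.2.1.2) T; last first.
  exists c; split=> // [y|n e r|n m e r t Ut].
  - exact/eqP/SV0.
  - by apply: (hc ((n, 0), (e, r, zerob))).
  - by apply: (hc ((n, m.+1), (e, r, t))).
set DD := [set y | _]%classic; set I := (fun y => bpair _ _).
have uI (E : set (baire * X)) : ucomp E I I by exact: ucomp_id.
have ust (E : set (baire * X)) :
    ucomp E I (fun y => consb y.2.1.1 (consb y.2.1.2 y.2.2.1.1)).
  apply: ucomp_ext (ucomp_odds (ucomp_evens (uI E))) _ => y _ k.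
  by rewrite evens_bpair odds_bpair.
have ur E : ucomp E I (fun y => y.2.2.1.2).
  by apply: ucomp_ext (ucomp_odds (uI E)) _ => y _ k; rewrite odds_bpair.
have ucc E : ucomp E I (fun y => y.1).
  apply: ucomp_ext (ucomp_evens (ucomp_evens (uI E))) _ => y _ k.
  by rewrite !evens_bpair.
have un E : ucomp E I (fun y => cst y.2.1.1) := ucomp_digit 0 (ust E).
have um E : ucomp E I (fun y => cst y.2.1.2) := ucomp_digit 1 (ust E).
have ue E : ucomp E I (fun y => y.2.2.1.1) := ucomp_tailb (ucomp_tailb (ust E)).
apply: ucomp_if0; first exact: um.
  by apply: ucomp_consb; [exact: ucomp_cst|apply: ucomp_bpair => //; exact: ucomp_bpair].
set DS := [set y | _]%classic.
have ut : ucomp DS I (fun y => y.2.2.2).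
  by apply: ucomp_U (ucomp_bpair (ue _) (ur _)) _ => y [Dy /Dy].
apply: ucomp_bpair; last exact: ucomp_odds.
apply: ucomp_comp; last by apply: (ucomp_sub (g := fun y => bpair y.1 (consb y.2.1.1
  (consb y.2.1.2.-1 (evens y.2.2.2)))) uSV).
apply: ucomp_bpair => //; apply: ucomp_consb => //; apply: ucomp_consb.
  by apply: ucomp_cst_recu (um _); recu_auto.
exact: ucomp_evens.
Qed.

Lemma for_loop_to_diamond g : exists K : baire -> baire,
  ucomp setT id K /\ forall t, mdom (fin_power g (t 0)) (odds t) ->
    mdom (diamond g) (K t) /\
    forall y, diamond g (K t) y -> evens (tailb y) 0 = t 0 /\
      fin_power g (t 0) (odds t) (odds (tailb y)).
Proof.
have [SV [c [uSV uc SV0 hlast hnext]]] := for_loop_machine.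
(* The counter starts one below the number of calls, because the machine halts on the answer that it
   receives with counter 0. *)
pose start t := bpair (SV (bpair c (consb (t 0) (consb (t 0).-1 (evens (odds t))))))
  (odds (odds t)).
(* With no calls the run halts at once, and behind the halting digit stands [t], already a name of
   the required pair. *)
exists (fun t => if t 0 == 0 then consb 0 t else start t); split.
  apply: (@ucomp_if0 _ _ id (fun t => t 0)); first exact: ucomp_digit (ucomp_id _ _).
    by apply: ucomp_consb; [exact: ucomp_cst|exact: ucomp_id].
  set E := [set t | _]%classic; have ui : ucomp E id id by exact: ucomp_id.
  apply: ucomp_bpair; last exact: (ucomp_odds (ucomp_odds ui)).
  apply: ucomp_comp; last by apply: (ucomp_sub (g := fun t => bpair c (consb (t 0)
    (consb (t 0).-1 (evens (odds t))))) uSV).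
  apply: ucomp_bpair => //; apply: ucomp_consb; first exact: (ucomp_digit 0 ui).
  apply: ucomp_consb; last exact: (ucomp_evens (ucomp_odds ui)).
  by apply: (ucomp_cst_recu (h := predn)) (ucomp_digit 0 ui); recu_auto.
move=> t; case: eqP => [t0 _|].
  have [h1 h2] := @diamond_inv g (consb 0 t) 0 (fun _ q => q = consb 0 t) erefl
    (fun _ _ h => False_ind _ (notF h)) (fun q e => congr1 (@^~ 0) e).
  by split=> // y /h2 ->; rewrite t0.
case E: (t 0) => [//|n] _ dom.
(* After [i] calls the state carries a query state of the loop and the counter [n - i]; call [n.+1]
   halts. *)
pose P i q := if i <= n then exists2 u, query_states g i (odds t) u &
    q = bpair (SV (bpair c (consb n.+1 (consb (n - i) (evens u))))) (odds u)
  else exists2 y, fin_power g n.+1 (odds t) y & q = consb 0 (bpair (cst n.+1) y).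
have [|i q iN|q|h1 h2] := @diamond_inv g (start t) n.+1 P.
- by exists (odds t) => //; rewrite /start E subn0.
- rewrite /P -ltnS iN => -[u hu ->].
  have domi : mdom (fin_power g i.+1) (odds t) by exact: fin_power_dom_le dom.
  have [|r|h1 h2] := @run_step_all g (bpair (SV (bpair c (consb n.+1
    (consb (n - i) (evens u))))) (odds u)) (P i.+1); last by split=> //; exact: SV0.
    by rewrite odds_bpair; exact: query_states_dom domi hu.
  rewrite odds_bpair evens_bpair => gr; have hy := fin_powerS_intro domi hu gr.
  rewrite ltnS in iN; case: (ltngtP i n) iN => // [iN|iN] _; last first.
    rewrite iN subnn; eexists; first exact: hlast.
    by rewrite /P ltnn; exists (bpair (evens u) r) => //; rewrite -iN.
  have domi2 : mdom (fin_power g i.+2) (odds t) by exact: fin_power_dom_le dom.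
  have [[t' Ut'] hs] := query_states_step domi2 hy.
  rewrite -(subnSK iN); eexists; first exact: hnext Ut'.
  by rewrite /P iN; exists t' => //; exact: hs.
- by rewrite /P ltnn => -[y _ ->].
split=> // y /h2; rewrite /P ltnn => -[z hz ->].
by rewrite tailb_consb evens_bpair odds_bpair.
Qed.

(** * Guessing prefixes of the answers *)

(** Each answer is used with the next word of [ws] in front, so the length of [ws] is the number of
    calls whatever the answers are. *)
Fixpoint good g (d : set baire) (ws : seq (seq nat)) (q : baire) : Prop :=
  if ws is w :: ws' then
    mdom g (odds q) /\ forall r, g (odds q) r ->
      exists2 q', U (bpair (evens q) (catw w r)) q' & good g d ws' q'
  else d q.

(* The longest word that is determined by [bpair (evens q) r], for [q] and [r]
   extending [a] and [w]. *)
Definition interleave (a w : seq nat) : seq nat :=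
  mkseq (fun i => if odd i then nth 0 w i./2 else nth 0 a i./2.*2)
    (minn (size a)./2 (size w)).*2.

Lemma interleave_word a w q r : word_prefix a q -> word_prefix w r ->
  word_prefix (interleave a w) (bpair (evens q) r).
Proof.
move=> aq wr; rewrite /word_prefix {2}/interleave size_mkseq.
apply/eq_in_map => i; rewrite mem_iota add0n /bpair => hi; case: ifP => oi.
  by rewrite (word_prefix_nth wr) //; lia.
by rewrite (word_prefix_nth aq) //; lia.
Qed.

Section Guess.
Context (phi : seq nat -> seq nat).

(** A step is simulated only if the first digit is known to be nonzero: on an empty word the default
    0 blocks it. For the same reason [accepts] asks for a nonempty word before it believes in a
    final 0. *)
Definition guess_step (o : option (seq nat)) (w : seq nat) : option (seq nat) :=
  if o is Some a then if 0 < nth 0 a 0 then Some (phi (interleave a w)) else None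
  else None.

Definition accepts (y : seq nat * seq (seq nat)) : bool :=
  if foldl guess_step (Some y.1) y.2 is Some a then (0 < size a) && (nth 0 a 0 == 0)
  else false.

Lemma accepts_cons a w ws : accepts (a, w :: ws) =
  (0 < nth 0 a 0) && accepts (phi (interleave a w), ws).
Proof.
rewrite /accepts /=; case: ifP => //= _.
by have -> : foldl guess_step None ws = None by elim: ws.
Qed.

Lemma recu_accepts : recu phi -> recu (fun y => accepts (y.1, decode_words y.2)).
Proof.
by move=> rphi; rewrite /accepts /guess_step /interleave /minn; recu_auto.
Qed.

Context (phiU : forall t q, U t q ->
  (forall s, word_prefix (phi (mkseq t s)) q) /\
  (forall n, exists s0, forall s, s0 <= s -> n <= size (phi (mkseq t s)))).

Context (g : multifun Baire Baire).
Context (g_catw : forall p r w, g p r -> g p (catw w r)).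

Lemma word_prefix_catw w r : word_prefix w (catw w r).
Proof.
apply: (@eq_from_nth _ 0) => [|i iw]; first by rewrite size_mkseq.
by rewrite nth_mkseq // /catw iw.
Qed.

(** The simulation computes prefixes of the states of a real run, since [catw w r] is again an
    answer. The history [Q] is carried along because only runs that start at [q0] are known not to
    stall. *)
Lemma accepts_good ws a q q0 Q k : mdom (diamond g) q0 -> Q 0 = q0 -> Q k = q ->
  (forall i, i < k -> run_step g (Q i) (Q i.+1)) ->
  (forall i, i < k -> Q i 0 <> 0) -> word_prefix a q -> accepts (a, ws) ->
  good g (diamond g q0) ws q.
Proof.
move=> [z [hruns _]] Q0; elim: ws a q k Q Q0 => [|w ws IH] a q k Q Q0 Qk hQ nzQ aq.
  rewrite /accepts /= => /andP[sa /eqP a0]; split=> //.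
  by exists Q, k; rewrite Qk; split=> //; split=> //; rewrite Qk -(word_prefix_nth aq).
rewrite accepts_cons => /andP[a0 acc].
have qn0 : q 0 <> 0.
  have sa : 0 < size a by case: (a) a0.
  by rewrite -(word_prefix_nth aq sa); lia.
(* Otherwise the history would be a stalling run. *)
have dq : mdom (run_step g) q.
  apply: contrapT => ndq; have [h _] := hruns Q Q0; apply: (h k).
  split; [exact: hQ|by rewrite Qk|move=> i].
  by rewrite leq_eqVlt => /orP[/eqP ->|]; [rewrite Qk|exact: nzQ].
have [dg hU] := run_step_dom dq; split=> // r gr.
have [q' Uq' step] := hU _ (g_catw w gr); exists q' => //.
pose Q' i := if i <= k then Q i else q'.
apply: (IH (phi (interleave a w)) q' k.+1 Q') => //.
- by rewrite /Q' ltnn.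
- move=> i; rewrite ltnS leq_eqVlt => /orP[/eqP ->|ik]; rewrite /Q'.
    by rewrite leqnn ltnn Qk.
  by rewrite ik (ltnW ik); exact: hQ.
- move=> i; rewrite ltnS /Q' => ik; rewrite ik.
  by move: ik; rewrite leq_eqVlt => /orP[/eqP ->|]; [rewrite Qk|exact: nzQ].
- have [h1 _] := phiU Uq'.
  by rewrite (interleave_word aq (word_prefix_catw w r)); exact: h1.
Qed.

(** The words are prefixes of the answers in the successful run, chosen from its end backwards: what
    is needed of the next state determines how much of the answer to keep. *)
Lemma successful_accepts Q k : successful g Q k ->
  exists ws s0, forall s, s0 <= s -> accepts (mkseq (Q 0) s, ws).
Proof.
elim: k Q => [|k IH] Q [h1 h2 h3].
  exists [::], 1 => s s1; rewrite /accepts /= size_mkseq s1 /=.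
  by rewrite nth_mkseq // h2.
have [ws [s0 hs0]] : exists ws s0, forall s, s0 <= s -> accepts (mkseq (Q 1) s, ws).
  apply: (IH (fun i => Q i.+1)); split=> // i ik; [exact: h1|exact: h3].
have [_ [_ [r gr <-] UQ1]] := h1 0 isT.
have [u1 u2] := phiU UQ1; have [s1 hs1] := u2 s0.
(* At this length the even half covers [s1] digits of the program, and the first digit of the state
   is known. *)
exists (mkseq r s1 :: ws), s1.*2.+1 => s hs.
rewrite accepts_cons nth_mkseq ?(leq_ltn_trans _ hs) // lt0n.
rewrite (introN eqP (h3 0 isT)) /=.
have iw := interleave_word (word_prefix_mkseq (Q 0) s) (word_prefix_mkseq r s1).
have si : s1 <= size (interleave (mkseq (Q 0) s) (mkseq r s1)).
  by rewrite !size_mkseq; lia.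
move: iw si; set v := interleave _ _ => iw si.
have := u1 (size v); rewrite -iw => pv; rewrite pv; apply: hs0.
by rewrite iw; exact: hs1.
Qed.

End Guess.

Lemma diamond_guess g : (forall p r w, g p r -> g p (catw w r)) ->
  exists N : baire -> nat,
    ucomp (mdom (diamond g)) id (fun q => cst (N q)) /\
    forall q, mdom (diamond g) q -> good g (diamond g q) (decode_words (N q)) q.
Proof.
move=> g_catw.
have [phi [rphi mphi hphi]] : ucomp [set y : baire * baire | U y.1 y.2]%classic fst snd.
  by apply: ucomp_U (ucomp_id _ _) _.
have phiU t q : U t q -> _ := fun Utq => hphi (t, q) Utq.
have [N [uN hN]] := search_witness (recu_accepts rphi).
have found q : mdom (diamond g) q ->
    exists s z, accepts phi (mkseq q s, decode_words z).
  move=> [y [_ [Q [k [<- sQ _]]]]]; have [ws [s hs]] := successful_accepts phiU sQ.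
  by exists s, (code_words ws); rewrite code_wordsK; exact: hs.
exists N; split.
  by apply: (ucomp_sub (g := id) uN) => q dq; split=> //; exact: found.
move=> q dq; have [s acc] := hN q (found q dq).
apply: (accepts_good phiU g_catw (Q := fun=> q) (k := 0) dq) acc => //.
exact: word_prefix_mkseq.
Qed.

(** * Running a sequence of diamond instances *)

Definition words_left z := size (decode_words z).
Definition next_word z := head [::] (decode_words z).
Definition drop_word z := code_words (drop 1 (decode_words z)).

Lemma recu_words_left : recu words_left.
Proof. by rewrite /words_left; recu_auto. Qed.

Lemma recu_next_word : recu next_word.
Proof.
apply: (@recu_ext _ _ _ _ (fun z => nth [::] (decode_words z) 0)); first by recu_auto.
by move=> z; rewrite /next_word nth0.
Qed.

Lemma recu_drop_word : recu drop_word.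
Proof. by rewrite /drop_word; recu_auto. Qed.

(* A state: instance [i] with current stage [t] and words [z] still to be
   prepended; [P] lists all instances, each one headed by its words. *)
Definition state i z (t P : baire) : baire := consb i (consb z (bpair t P)).

Definition stage (y : baire) : baire := evens (tailb (tailb y)).

Definition instances (y : baire) : baire := odds (tailb (tailb y)).

(** A stage with no words left is final; its question is replaced by the dummy [s]. *)
Definition load (SV : baire -> baire) (c s : baire) i z t P : baire :=
  bpair (SV (bpair c (state i z t P))) (if words_left z == 0 then s else odds t).

Definition load_instance SV c s P i :=
  load SV c s i (bproj P i 0) (tailb (bproj P i)) P.

Lemma ucomp_load SV s X (D : set X) I (i z : X -> nat) c t P :
  ucomp setT id SV -> (forall E : set X, ucomp E I (fun=> s)) ->
  ucomp D I c -> ucomp D I (fun x => cst (i x)) -> ucomp D I (fun x => cst (z x)) ->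
  ucomp D I t -> ucomp D I P ->
  ucomp D I (fun x => load SV (c x) s (i x) (z x) (t x) (P x)).
Proof.
move=> uSV us uc ui uz ut uP; apply: ucomp_bpair.
  apply: ucomp_comp; last by apply: (ucomp_sub
    (g := fun x => bpair (c x) (state (i x) (z x) (t x) (P x))) uSV).
  apply: ucomp_bpair => //; apply: ucomp_consb => //; apply: ucomp_consb => //.
  exact: ucomp_bpair.
apply: ucomp_if0 => //; first exact: (ucomp_cst_recu recu_words_left uz).
by apply: ucomp_odds; apply: (ucomp_sub (g := id) ut) => x [].
Qed.

Lemma ucomp_load_instance SV s X (D : set X) I (i : X -> nat) c P :
  ucomp setT id SV -> (forall E : set X, ucomp E I (fun=> s)) ->
  ucomp D I c -> ucomp D I (fun x => cst (i x)) -> ucomp D I P ->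
  ucomp D I (fun x => load_instance SV (c x) s (P x) (i x)).
Proof.
move=> uSV us uc ui uP; have ub := ucomp_bproj ui uP.
by apply: ucomp_load => //; [exact: (ucomp_digit 0 ub)|exact: ucomp_tailb].
Qed.

(** The two transitions are the dummy call, which loads the next instance, and a call whose answer
    gets the next word in front. The equation for [name_arg] is what lets the post-processing see
    the state. *)
Lemma batch_machine s : (forall Y (E : set Y) J, ucomp E J (fun=> s)) ->
  exists (SV : baire -> baire) (c : baire),
  [/\ ucomp setT id SV, forall Y (E : set Y) J, ucomp E J (fun=> c),
    forall y, name_arg (SV y) = y,
    forall i z t P r, words_left z = 0 ->
      U (bpair (SV (bpair c (state i z t P))) r) (load_instance SV c s P i.+1) &
    forall i z t P r t', words_left z <> 0 ->
      U (bpair (evens t) (catw (next_word z) r)) t' ->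
      U (bpair (SV (bpair c (state i z t P))) r) (load SV c s i (drop_word z) t' P)].
Proof.
move=> us; have [SV [uSV SVK _ hSV]] := recursion_theorem; exists SV.
pose X := ((nat * nat) * (baire * baire) * (baire * baire))%type.
pose D := [set x : X | words_left x.1.1.2 <> 0 ->
  U (bpair (evens x.1.2.1) (catw (next_word x.1.1.2) x.2.1)) x.2.2]%classic.
pose T (c : baire) (x : X) := if words_left x.1.1.2 == 0
  then load_instance SV c s x.1.2.2 x.1.1.1.+1
  else load SV c s x.1.1.1 (drop_word x.1.1.2) x.2.2 x.1.2.2.
have [|c [uc hc]] := @hSV X D (fun x => state x.1.1.1 x.1.1.2 x.1.2.1 x.1.2.2)
    (fun x => x.2.1) T; last first.
  exists c; split=> // [i z t P r z0|i z t P r t' z0 Ut].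
  - have := hc ((i, z), (t, P), (r, zerob)); rewrite /T /= z0 eqxx; apply.
    by rewrite /D /=.
  - have := hc ((i, z), (t, P), (r, t')); rewrite /T /= (introF eqP z0); exact.
set DD := [set y | _]%classic; set I := (fun y => bpair _ _).
have uI (E : set (baire * X)) : ucomp E I I by exact: ucomp_id.
have ust (E : set (baire * X)) :
    ucomp E I (fun y => state y.2.1.1.1 y.2.1.1.2 y.2.1.2.1 y.2.1.2.2).
  apply: ucomp_ext (ucomp_odds (ucomp_evens (uI E))) _ => y _ k.
  by rewrite evens_bpair odds_bpair.
have ur E : ucomp E I (fun y => y.2.2.1).
  by apply: ucomp_ext (ucomp_odds (uI E)) _ => y _ k; rewrite odds_bpair.
have ucc E : ucomp E I (fun y => y.1).
  apply: ucomp_ext (ucomp_evens (ucomp_evens (uI E))) _ => y _ k.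
  by rewrite !evens_bpair.
have ui E : ucomp E I (fun y => cst y.2.1.1.1) := ucomp_digit 0 (ust E).
have uz E : ucomp E I (fun y => cst y.2.1.1.2) := ucomp_digit 1 (ust E).
have utP E := ucomp_tailb (ucomp_tailb (ust E)).
have ut E : ucomp E I (fun y => y.2.1.2.1).
  apply: ucomp_ext (ucomp_evens (utP E)) _ => y _ k.
  by rewrite /state !tailb_consb evens_bpair.
have uP E : ucomp E I (fun y => y.2.1.2.2).
  apply: ucomp_ext (ucomp_odds (utP E)) _ => y _ k.
  by rewrite /state !tailb_consb odds_bpair.
apply: ucomp_if0; first exact: (ucomp_cst_recu recu_words_left (uz _)).
  apply: ucomp_load_instance => //.
  by apply: (ucomp_cst_recu (h := succn)) (ui _); recu_auto.
apply: ucomp_load => //; first exact: (ucomp_cst_recu recu_drop_word (uz _)).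
have uw E := ucomp_catw recu_next_word (uz E) (ur E).
by apply: ucomp_U (ucomp_bpair (ucomp_evens (ut _)) (uw _)) _ => y [Dy /Dy].
Qed.

(** The instance and the remaining words after [n] calls depend on [P] only and not on the answers;
    hence the post-processing can compute where to look. *)
Fixpoint schedule (P : baire) n : nat * nat :=
  if n is n'.+1 then
    let: (i, z) := schedule P n' in
    if words_left z == 0 then (i.+1, bproj P i.+1 0) else (i, drop_word z)
  else (0, bproj P 0 0).

(* The number of calls spent before instance [i]: the calls of each earlier
   instance, and one dummy call after each of them. *)
Definition clock P i :=
  nat_rect (fun=> nat) 0 (fun j r => r + (words_left (bproj P j 0)).+1) i.

Lemma schedule_drop P m i z j : schedule P m = (i, z) -> j <= words_left z ->
  exists2 z', schedule P (m + j) = (i, z') & decode_words z' = drop j (decode_words z).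
Proof.
move=> mi; elim: j => [|j IH] jz; first by exists z; rewrite ?addn0 ?drop0.
have [z' ej ez'] := IH (ltnW jz); exists (drop_word z'); last first.
  by rewrite /drop_word code_wordsK ez' drop_drop add1n.
rewrite addnS /= ej ifF // /words_left ez' size_drop.
by move: jz; rewrite /words_left; lia.
Qed.

Lemma schedule_clock P i : schedule P (clock P i) = (i, bproj P i 0).
Proof.
elim: i => //= i IH; rewrite -/(clock P i) addnS.
have [z' ej ez'] := schedule_drop IH (leqnn _).
by rewrite /= ej /words_left ez' size_drop subnn.
Qed.

Lemma ucomp_clock X (D : set X) I (i : X -> nat) P :
  ucomp D I (fun x => cst (i x)) -> ucomp D I P ->
  ucomp D I (fun x => cst (clock (P x) (i x).+1)).
Proof.
move=> ui uP.
have rw := recu_words_left.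
(* The codes of [(j, 0)] increase with [j], so a segment that contains the one for [i] contains all
   word lists up to instance [i]. *)
apply: (ucomp_ext (ucomp_cst_local (b := fun i => (Cantor.to_nat (i, 0)).+1)
  (h := fun y => nat_rect (fun=> nat) 0
    (fun j r => r + (words_left (nth 0 y.2 (Cantor.to_nat (j, 0)))).+1) y.1.+1) _ _ ui uP)).
- by recu_auto.
- by recu_auto.
move=> x _ k; rewrite /cst; cbn [fst snd]; rewrite /clock.
elim: {-2}(i x).+1 (leqnn (i x).+1) => // j IH jx /=.
rewrite -[RHS]/(_ + _) -IH ?(ltnW jx) //; congr (_ + (words_left _).+1).
by rewrite -[LHS]/(nth 0 (mkseq _ _) _) nth_mkseq // ltnS; exact: tri_homo.
Qed.

Section Batch.
Context (g : multifun Baire Baire) (SV : baire -> baire) (c s : baire).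
Context (hnext : forall i z t P r, words_left z = 0 ->
  U (bpair (SV (bpair c (state i z t P))) r) (load_instance SV c s P i.+1)).
Context (hstep : forall i z t P r t', words_left z <> 0 ->
  U (bpair (evens t) (catw (next_word z) r)) t' ->
  U (bpair (SV (bpair c (state i z t P))) r) (load SV c s i (drop_word z) t' P)).
Context (P : baire) (validP : forall i, good g (diamond g (tailb (bproj P i)))
  (decode_words (bproj P i 0)) (tailb (bproj P i))).

Definition batch_inv n (t : baire) :=
  exists2 u, t = load SV c s (schedule P n).1 (schedule P n).2 u P &
    good g (diamond g (tailb (bproj P (schedule P n).1)))
      (decode_words (schedule P n).2) u.

Lemma batch_inv_step n t r : batch_inv n t -> g (odds t) r ->
  exists2 t', U (bpair (evens t) r) t' & batch_inv n.+1 t'.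
Proof.
move=> [u ->]; rewrite evens_bpair odds_bpair /batch_inv /=.
case: (schedule P n) => i z /= gu; case: eqP => [z0 _|zn0].
  by eexists; [exact: hnext|exists (tailb (bproj P i.+1)); [|exact: validP]].
move: gu; have := zn0; rewrite /words_left; case E: (decode_words z) => [//|w ws] _.
move=> [_ hu] /hu[t' Ut' gt']; exists (load SV c s i (drop_word z) t' P).
  by apply: hstep => //; rewrite /next_word E.
by exists t' => //; rewrite /drop_word code_wordsK E /= drop0.
Qed.

Lemma batch_inv_dom n t : words_left (schedule P n).2 <> 0 \/ mdom g s ->
  batch_inv n t -> mdom g (odds t).
Proof.
move=> h [u -> gu]; rewrite odds_bpair.
case: eqP => [z0|zn0]; first by case: h.
by move: zn0 gu; rewrite /words_left; case: (decode_words _) => [//|w ws] _ [].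
Qed.

(** The first alternative serves a single instance, which is left before its words run out and so
    never asks [s]; the second serves the endless batch of the pointed case. *)
Lemma batch_power n :
  (forall m, m <= n -> words_left (schedule P m).2 <> 0 \/ mdom g s) ->
  mdom (fin_power g n.+1) (load_instance SV c s P 0) /\
  forall y, fin_power g n.+1 (load_instance SV c s P 0) y ->
    exists u r, [/\ y = bpair (SV (bpair c
        (state (schedule P n).1 (schedule P n).2 u P))) r,
      g (odds (load SV c s (schedule P n).1 (schedule P n).2 u P)) r &
      good g (diamond g (tailb (bproj P (schedule P n).1)))
        (decode_words (schedule P n).2) u].
Proof.
move=> hdom.
have [|i t iN Jt|i t r _ Jt gr|h1 h2] :=
  @fin_power_inv g (load_instance SV c s P 0) batch_inv n.
- by exists (tailb (bproj P 0)); [|exact: validP].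
- exact: batch_inv_dom (hdom i iN) Jt.
- exact: batch_inv_step Jt gr.
split=> // y /h2[t [r [[u et gu] gr ->]]]; exists u, r; split=> //.
  by rewrite et evens_bpair.
by rewrite -et.
Qed.

End Batch.

(** The post-processing recovers the last stage and word from the stored state and carries out the
    remaining application of [U]. *)
Lemma diamond_to_for_loop g : (forall p r w, g p r -> g p (catw w r)) ->
  exists (K : baire -> baire) (D : set (baire * baire)),
  [/\ ucomp (mdom (diamond g)) id K, ucomp D fst snd &
    forall q, mdom (diamond g) q ->
      mdom (fin_power g (evens (K q) 0)) (odds (K q)) /\
      forall h, evens h 0 = evens (K q) 0 ->
        fin_power g (evens (K q) 0) (odds (K q)) (odds h) ->
        exists2 y, D (h, y) & diamond g q y].
Proof.
move=> g_catw; have [N [uN gN]] := diamond_guess g_catw.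
have us Y (E : set Y) J : ucomp E J (fun=> zerob) by exact: ucomp_cst.
have [SV [c [uSV uc SVK hnext hstep]]] := batch_machine us.
(* The batch machine expects a sequence of instances; only instance 0 is run. *)
pose copies q := btuple (fun=> consb (N q) q).
have copiesE q i : bproj (copies q) i = consb (N q) q by rewrite bproj_btuple.
pose K q := bpair (cst (words_left (N q))) (load_instance SV c zerob (copies q) 0).
pose st (h : baire) := odds (name_arg (evens (odds h))).
pose next (h : baire) := bpair (evens (stage (st h))) (catw (next_word (st h 1)) (odds (odds h))).
pose D := [set y : baire * baire |
  if evens y.1 0 == 0 then stage (st y.1) = y.2 else U (next y.1) y.2]%classic.
have uid X (E : set X) (J : X -> baire) : ucomp E J J by exact: ucomp_id.
have ust E : ucomp E fst (fun y : baire * baire => st y.1).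
  by apply: ucomp_odds; apply: ucomp_name_arg; apply: ucomp_evens; exact: ucomp_odds.
have usg E : ucomp E fst (fun y : baire * baire => stage (st y.1)).
  exact: (ucomp_evens (ucomp_tailb (ucomp_tailb (ust E)))).
exists K, D; split.
- apply: ucomp_bpair; first exact: (ucomp_cst_recu recu_words_left uN).
  apply: (ucomp_load_instance (c := fun=> c) (P := copies) (i := fun=> 0)) => //.
  apply: ucomp_btuple.
  have utl E : ucomp E (fun y : baire * nat => consb y.2 y.1) fst.
    exact: (ucomp_tailb (uid _ E (fun y : baire * nat => consb y.2 y.1))).
  apply: ucomp_consb; last exact: utl.
  by apply: ucomp_comp (utl _) _; apply: (ucomp_sub (g := fst) uN).
(* Writing the target as a conditional with equal branches lets the two cases of [D] be treated by
   different computations. *)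
- apply: (ucomp_ext (T := fun y => if evens y.1 0 == 0 then y.2 else y.2)).
    apply: ucomp_if0.
    + exact: (ucomp_digit 0 (ucomp_evens (uid _ _ _))).
    + by apply: ucomp_ext (usg _) _ => y [Dy y0] k; move: Dy; rewrite /D /= y0 /= => ->.
    + apply: (@ucomp_U _ _ _ (fun y => next y.1)).
        apply: ucomp_bpair; first exact: (ucomp_evens (usg _)).
        apply: (ucomp_catw recu_next_word); first exact: (ucomp_digit 1 (ust _)).
        exact: (ucomp_odds (ucomp_odds (uid _ _ _))).
      by move=> y [Dy /eqP/negbTE y0]; move: Dy; rewrite /D /= y0.
  by move=> y _ k; case: ifP.
move=> q dq; have validP i : good g (diamond g (tailb (bproj (copies q) i)))
    (decode_words (bproj (copies q) i 0)) (tailb (bproj (copies q) i)).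
  by rewrite copiesE; exact: gN.
have start : schedule (copies q) 0 = (0, N q) by rewrite /= copiesE.
rewrite /K evens_bpair odds_bpair /cst; case E: (words_left (N q)) => [|k].
  (* With no words [q] is its own result, and the power 0 returns the input, from whose name [q] is
     read. *)
  split=> [|h h0 /= eh]; first by exists (load_instance SV c zerob (copies q) 0).
  exists q; last by have := gN q dq; move: E; rewrite /words_left; case: (decode_words _).
  rewrite /D /= h0 /= /st eh evens_bpair SVK odds_bpair.
  by rewrite copiesE /stage /state !tailb_consb evens_bpair.
have sched j : j <= k.+1 -> exists2 z, schedule (copies q) j = (0, z) &
    decode_words z = drop j (decode_words (N q)).
  by rewrite -E => /(schedule_drop start).
have [|h1 h2] := batch_power hnext hstep validP (n := k).
  move=> m mk; left; have [z -> ez] := sched m (leqW mk).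
  by rewrite /words_left ez size_drop; move: E; rewrite /words_left; lia.
split=> // h hk /h2[u [r []]]; have [z -> ez] := sched k (leqnSn k).
(* Of the [k.+1] words [k] are spent, so the last answer meets the last word. *)
have [w ew] : exists w, decode_words z = [:: w].
  have : words_left z = 1.
    by rewrite /words_left ez size_drop; move: E; rewrite /words_left; lia.
  by rewrite /words_left; case: (decode_words z) => [|w []] //; exists w.
rewrite copiesE tailb_consb [_.1]/= [_.2]/= ew => eh.
rewrite /load odds_bpair /words_left ew /= => gr [_ /(_ r gr)[y Uy gy]].
exists y => //; rewrite /D /= hk /= /next /st eh evens_bpair odds_bpair SVK odds_bpair.
by rewrite /stage /state !tailb_consb evens_bpair /= /next_word ew.
Qed.

Lemma parallel_diamond_to_omega g s : (forall p r w, g p r -> g p (catw w r)) ->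
  (forall Y (E : set Y) J, ucomp E J (fun=> s)) -> mdom g s ->
  exists K H : baire -> baire,
  [/\ ucomp [set p | forall i, mdom (diamond g) (bproj p i)]%classic id K,
    ucomp setT id H &
    forall p, (forall i, mdom (diamond g) (bproj p i)) ->
      mdom (omega g) (K p) /\
      forall y, omega g (K p) y -> forall i, diamond g (bproj p i) (bproj (H y) i)].
Proof.
move=> g_catw us dom_s; have [N [uN gN]] := diamond_guess g_catw.
have [SV [c [uSV uc SVK hnext hstep]]] := batch_machine us.
pose inst p := btuple (fun i => consb (N (bproj p i)) (bproj p i)).
have instE p i : bproj (inst p) i = consb (N (bproj p i)) (bproj p i).
  by rewrite bproj_btuple.
pose st y n := odds (name_arg (evens (bproj y n))).
(* The power 0 is the input itself, whose name stores all instances and hence the clock. Power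
   [n.+1] shows the state after [n] calls, so the power numbered by the clock of [i.+1] shows
   instance [i] at its dummy call, in its final stage. *)
pose H y := btuple (fun i => stage (st y (clock (instances (st y 0)) i.+1))).
have uid X (E : set X) (J : X -> baire) : ucomp E J J by exact: ucomp_id.
have uhd (E : set (baire * nat)) : ucomp E (fun y => consb y.2 y.1) (fun y => cst y.2).
  exact: (ucomp_digit 0 (uid _ E (fun y => consb y.2 y.1))).
have utl (E : set (baire * nat)) : ucomp E (fun y => consb y.2 y.1) fst.
  exact: (ucomp_tailb (uid _ E (fun y => consb y.2 y.1))).
exists (fun p => load_instance SV c s (inst p) 0), H; split.
- apply: (ucomp_load_instance (c := fun=> c) (i := fun=> 0)) => //.
    exact: ucomp_cst.
  apply: ucomp_btuple; have up E := ucomp_bproj (uhd E) (utl E).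
  apply: ucomp_consb => //; apply: ucomp_comp (up _) _.
  by apply: (ucomp_sub (g := fun y => bproj y.1 y.2) uN) => -[p i] /= hp.
- apply: ucomp_btuple.
  have uP E : ucomp E (fun y : baire * nat => consb y.2 y.1)
      (fun y => instances (st y.1 0)).
    apply: ucomp_odds; apply: ucomp_tailb; apply: ucomp_tailb; apply: ucomp_odds.
    apply: ucomp_name_arg; apply: ucomp_evens.
    by apply: (ucomp_bproj (N := fun=> 0)) => //; exact: ucomp_cst.
  apply: ucomp_evens; apply: ucomp_tailb; apply: ucomp_tailb; apply: ucomp_odds.
  apply: ucomp_name_arg; apply: ucomp_evens; apply: ucomp_bproj => //.
  exact: ucomp_clock.
move=> p hp; have validP i : good g (diamond g (tailb (bproj (inst p) i)))
    (decode_words (bproj (inst p) i 0)) (tailb (bproj (inst p) i)).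
  by rewrite instE tailb_consb; exact: gN (hp i).
have hdom n m : m <= n -> words_left (schedule (inst p) m).2 <> 0 \/ mdom g s.
  by move=> _; right.
have power n := batch_power hnext hstep validP (hdom n).
split.
  have ex n : exists r, fin_power g n (load_instance SV c s (inst p) 0) r.
    by case: n => [|n]; [exists (load_instance SV c s (inst p) 0)|have [] := power n].
  by have [r hr] := choice ex; exists (btuple r), r.
move=> _ [r hr <-] i; rewrite /H /st !bproj_btuple.
have -> : instances (odds (name_arg (evens (r 0)))) = inst p.
  have -> : r 0 = load_instance SV c s (inst p) 0 := hr 0.
  rewrite /load_instance /load evens_bpair SVK odds_bpair.
  by rewrite /instances /state !tailb_consb odds_bpair.
rewrite /= -/(clock _ i) addnS.
have [z' ej ez'] := schedule_drop (schedule_clock (inst p) i) (leqnn _).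
have [_ /(_ _ (hr _))] := power (clock (inst p) i + words_left (bproj (inst p) i 0)).
move=> [u [r' [-> _]]]; rewrite ej /= ez' drop_size instE tailb_consb /=.
by rewrite evens_bpair SVK odds_bpair /stage /state !tailb_consb evens_bpair.
Qed.

(** * Strong Weihrauch reductions *)

(** The index sets [A] and [B] may carry more than the input, such as the value of a partial map, so
    that [K] and [H] need not be total on sequences. *)
Lemma sW_le_intro (X Y Z T : repSpace) (f : multifun X Y) (g : multifun Z T)
    A (DA : set A) (I K : A -> baire) B (DB : set B) (J H : B -> baire) :
  ucomp DA I K -> ucomp DB J H ->
  (forall p x, rep X p x -> mdom f x -> exists a, [/\ DA a, I a = p &
    exists z, [/\ rep Z (K a) z, mdom g z & forall q y, rep T q y -> g z y ->
      exists b, [/\ DB b, J b = q & exists2 y', rep Y (H b) y' & f x y']]]) ->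
  sW_le f g.
Proof.
move=> /ucomp_computable[FK [cK hK]] /ucomp_computable[FH [cH hH]] h.
exists FH, FK; split=> // G rG p x px dx.
have [a [Da <- [z [Kz dz hz]]]] := h p x px dx.
have [q [y [Gq qy gy]]] := rG _ _ Kz dz.
have [b [Db bq [y' Hy' fy']]] := hz q y qy gy.
by exists (H b), y'; split=> //; rewrite hK //= Gq /= -bq hH.
Qed.

(** The reduction is applied to a realizer that is undefined outside the names of points in the
    domain. As it still succeeds on [zerob], the query [K zerob] is such a name, and it is
    computable. *)
Lemma pointed_computable_input (f : multifun Degrees Degrees) :
  is_problem f -> pointed f ->
  exists s, (forall Y (E : set Y) J, ucomp E J (fun=> s)) /\
    mdom (realizer_version f) s.
Proof.
move=> [G0 rG0] [H [K [_ cK hK]]].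
pose dom p := exists2 d, rep Degrees p d & mdom f d.
pose G p := if pselect (dom p) is left _ then G0 p else None.
have rG : realizer G f.
  by move=> p d pd fd; rewrite /G; case: pselect => [_|[]]; [exact: rG0|exists d].
have [q [_ [+ _ _]]] := hK G rG zerob zerob erefl (ex_intro _ zerob erefl).
case E: (K zerob) => [s|] //=; rewrite /G; case: pselect => // -[d sd [e fe]] _.
exists s; split.
  move=> Y E0 J; apply: ucomp_comp (ucomp_cst _ _ 0) _.
  exact: (ucomp_sub (g := fun=> (zerob, s)) (computable_ucomp cK)).
have [z ze] := rep_surjective e; exists z; split.
  by move=> e' _; exact: rep_surjective.
exists e => //; split; last by exists d.
by move=> d' sd'; rewrite (rep_functional sd' sd); exists e.
Qed.

Theorem proposition29 (f : multifun Degrees Degrees) (fP : is_problem f) :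
  sW_equiv (diamond (realizer_version f)) (for_loop (realizer_version f)) /\
  (pointed f ->
   sW_equiv (parallel (diamond (realizer_version f)))
            (omega (realizer_version f))).
Proof.
set g := realizer_version f.
have g_catw p r w : g p r -> g p (catw w r) by exact: realizer_version_catw.
have [K1 [uK1 hK1]] := for_loop_to_diamond g.
split; first split.
- have [K [D [uK uD hK]]] := diamond_to_for_loop g_catw.
  apply: (sW_le_intro uK uD) => q _ -> dq; have [dom hH] := hK q dq.
  exists q; split=> //; exists (evens (K q) 0, odds (K q)); split=> //.
    by have [y hy] := dom; exists (evens (K q) 0, y).
  move=> h y [/= h0 hodds] [/= e0 hy]; have [||z Dz dz] := hH h.
  + by rewrite -h0 e0.
  + by rewrite -hodds.
  + by exists (h, z); split=> //; exists z.
- apply: (sW_le_intro uK1 (ucomp_tailb (ucomp_id setT (fun y : baire => y)))).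
  move=> t [n p] [/= n0 ->] [[m y0] [/= _ hy0]].
  have [|dom hH] := hK1 t; first by exists y0; rewrite -[t 0]/(evens t 0) -n0.
  exists t; split=> //; exists (K1 t); split=> // q _ -> /hH[e0 hq].
  exists q; split=> //; exists (n, odds (tailb q)); first by rewrite /= e0 n0.
  by split=> //=; rewrite n0.
move=> pt; have [s [us dom_s]] := pointed_computable_input fP pt.
have [K2 [H2 [uK2 uH2 h2]]] := parallel_diamond_to_omega g_catw us dom_s.
split.
- apply: (sW_le_intro uK2 uH2) => p x px [y0 hy0].
  have xE i : x i = bproj p i := px i.
  have [|dom hH] := h2 p; first by move=> i; exists (y0 i); rewrite -xE.
  exists p; split=> //; first by move=> i; exists (y0 i); rewrite -xE.
  exists (K2 p); split=> // q _ -> /hH hq.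
  exists q; split=> //; exists (bproj (H2 q)) => // i.
  by rewrite xE; exact: hq.
(* The remaining reduction is componentwise: [omega] collects the loops with 0, 1, 2, ... calls on
   the same [p], and component [n] is the [diamond] instance for the pair of [n] and [p]. *)
have u1 (E : set (baire * nat)) : ucomp E (fun y => consb y.2 y.1)
    (fun y => bpair (cst y.2) y.1).
  have uI : ucomp E (fun y => consb y.2 y.1) (fun y => consb y.2 y.1).
    exact: ucomp_id.
  by apply: ucomp_bpair; [exact: (ucomp_digit 0 uI)|exact: (ucomp_tailb uI)].
have uK : ucomp (@setT baire) id (fun p => btuple (fun n => K1 (bpair (cst n) p))).
  apply: ucomp_btuple; apply: ucomp_comp (u1 _) _.
  exact: (ucomp_sub (g := fun y => bpair (cst y.2) y.1) uK1).
have uH : ucomp (@setT baire) id (fun y => btuple (fun n => odds (tailb (bproj y n)))).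
  apply: ucomp_btuple; set E := [set y | _]%classic.
  have uI : ucomp E (fun y => consb y.2 y.1) (fun y => consb y.2 y.1).
    exact: ucomp_id.
  exact: (ucomp_odds (ucomp_tailb (ucomp_bproj (ucomp_digit 0 uI) (ucomp_tailb uI)))).
apply: (sW_le_intro uK uH) => p _ -> [_ [r0 hr0 _]].
have hn n : mdom (diamond g) (K1 (bpair (cst n) p)) /\
    forall y, diamond g (K1 (bpair (cst n) p)) y -> fin_power g n p (odds (tailb y)).
  have := hK1 (bpair (cst n) p); rewrite odds_bpair => -[|dom hy].
    by exists (r0 n); exact: hr0.
  by split=> // y /hy[].
exists p; split=> //; exists (fun n => K1 (bpair (cst n) p)); split.
- by move=> n; rewrite /= bproj_btuple.
- by have [y hy] := choice (fun n => proj1 (hn n)); exists y.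
move=> q y qy hy; exists q; split=> //; eexists; first by [].
exists (fun n => odds (tailb (bproj q n))) => // n.
by apply: (proj2 (hn n)); rewrite -(qy n); exact: hy.
Qed.
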